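(* Let $\mathbb{C}$ be a finitely cocomplete locally cartesian closed category, let $m\colon U\to V$ be a map in $\mathbb{C}/I$, and fix a map $Y\to J$ in $\mathbb{C}$. Then step 1 of the small object argument at $Y$, the pointed endofunctor $R_1\colon\mathbb{C}/Y\to\mathbb{C}/Y$ determined by $m$, is a pointed polynomial endofunctor.
   Context: Polynomials with reductions. For a map $u$ write $\Sigma_u\dashv u^*\dashv\Pi_u$. A polynomial with reductions is a diagram $R \xrightarrow{k} X \xrightarrow{f} D \xrightarrow{g} Z$ together with $h\colon X\to Z$ such that $g\circ f\circ k=h\circ k$. Its pointed endofunctor $P_{f,g,h,k}$ on $\mathbb{C}/Z$ is the pushout of $$\operatorname{Id}_{\mathbb{C}/Z}\longleftarrow \Sigma_h\Sigma_k k^*f^*\Pi_f h^*=\Sigma_g\Sigma_f\Sigma_k k^*f^*\Pi_f h^*\longrightarrow \Sigma_g\Pi_f h^*,$$ where the left map is the composite of the counits of $f^*\dashv\Pi_f$, $\Sigma_k\dashv k^*$, $\Sigma_h\dashv h^*$, and the right map is the composite of the counits of $\Sigma_k\dashv k^*$ and $\Sigma_f\dashv f^*$; the point is the pushout inclusion. A pointed endofunctor is pointed polynomial if it is (up to isomorphism of pointed endofunctors) of this form. Lifting problems. For $f\colon X\to Y$ in $\mathbb{C}/J$, a family of lifting problems from $m$ to $f$ over $K\in\mathbb{C}$ consists of maps $\sigma\colon K\to I$, $K\to J$ and maps $\sigma^*(U)\to X$, $\sigma^*(V)\to Y$ such that the square with $\sigma^*(m)$ and $f$, and the square from $\sigma^*(V)\to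 K$ to $Y\to J$, commute. Regarding $V$ as a family $V(i)$ over $I$, $U$ as a family $U(i,v)$ over $V$, $Y$ as a family $Y(j)$ over $J$, and $X$ as a family $X(j,y)$ over $Y$, the universal family of lifting problems from $m$ to $f$ is the one over $$K=\Sigma_{i:I}\Sigma_{j:J}\Sigma_{\beta:V(i)\to Y(j)}\Pi_{v:V(i)}\bigl(U(i,v)\to X(j,\beta(v))\bigr),$$ with $K\to I$, $K\to J$ the projections and $\sigma^*(U)\to X$, $\sigma^*(V)\to Y$ given by evaluation. Step 1 of the small object argument at $Y$: for $f\colon X\to Y$ in $\mathbb{C}/Y$, take the universal family of lifting problems from $m$ to $f$, let $K_1f$ be the pushout of $\sigma^*(V)\leftarrow\sigma^*(U)\to X$, let $R_1f\colon K_1f\to Y$ be the map induced by $\sigma^*(V)\to Y$ and $f$, and let the unit at $f$ be the pushout inclusion $\lambda_f\colon X\to K_1f$. *)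

(* Defs.v *)
From Stdlib Require Import ssreflect ProofIrrelevance List.

Set Implicit Arguments.
Unset Strict Implicit.
Unset Printing Implicit Defensive.

Record Category := {
  Ob :> Type;
  Hom : Ob -> Ob -> Type;
  idm : forall x, Hom x x;
  comp : forall x y z, Hom y z -> Hom x y -> Hom x z;
  comp_idl : forall x y (f : Hom x y), comp (idm y) f = f;
  comp_idr : forall x y (f : Hom x y), comp f (idm x) = f;
  comp_assoc : forall w x y z (h : Hom y z) (g : Hom x y) (f : Hom w x),
    comp h (comp g f) = comp (comp h g) f
}.
Arguments Hom {c} x y.
Arguments idm {c} x.
Arguments comp {c x y z} g f.

Notation "g ∘ f" := (comp g f) (at level 40, left associativity).

Record Functor (C D : Category) := {
  fobj :> C -> D;
  fmap : forall x y, Hom x y -> Hom (fobj x) (fobj y);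
  fmap_id : forall x, fmap (idm x) = idm (fobj x);
  fmap_comp : forall x y z (g : Hom y z) (f : Hom x y),
    fmap (g ∘ f) = fmap g ∘ fmap f
}.
Arguments fmap {C D} F {x y} f : rename.

Program Definition id_functor (C : Category) : Functor C C :=
  {| fobj := fun x => x; fmap := fun _ _ f => f |}.

Program Definition comp_functor (C D E : Category)
    (G : Functor D E) (F : Functor C D) : Functor C E :=
  {| fobj := fun x => G (F x); fmap := fun _ _ f => fmap G (fmap F f) |}.
Next Obligation. by rewrite !fmap_id. Qed.
Next Obligation. by rewrite !fmap_comp. Qed.

Notation "G ∘F F" := (comp_functor G F) (at level 40, left associativity).

Record NatTrans (C D : Category) (F G : Functor C D) := {
  nt :> forall x, Hom (F x) (G x);
  nt_nat : forall x y (f : Hom x y), nt y ∘ fmap F f = fmap G f ∘ nt x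
}.

Record Adjunction (C D : Category) (L : Functor C D) (R : Functor D C) := {
  adj_unit : NatTrans (id_functor C) (R ∘F L);
  adj_counit : NatTrans (L ∘F R) (id_functor D);
  triangle_l : forall x, adj_counit (L x) ∘ fmap L (adj_unit x) = idm (L x);
  triangle_r : forall y, fmap R (adj_counit y) ∘ adj_unit (R y) = idm (R y)
}.

Record Cocone (J C : Category) (D : Functor J C) (c : C) := {
  leg :> forall j, Hom (D j) c;
  leg_nat : forall i j (u : Hom i j), leg j ∘ fmap D u = leg i
}.

Record Colimit (J C : Category) (D : Functor J C) := {
  colim : C;
  colim_cocone : Cocone D colim;
  colim_desc : forall c, Cocone D c -> Hom colim c;
  colim_desc_leg : forall c (k : Cocone D c) j,
    colim_desc k ∘ colim_cocone j = k j;
  colim_desc_uniq : forall c (k : Cocone D c) (h : Hom colim c),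
    (forall j, h ∘ colim_cocone j = k j) -> h = colim_desc k
}.

Definition finite_type (T : Type) : Prop := exists l : list T, forall x, In x l.

Definition finite_category (J : Category) : Prop :=
  finite_type J /\ forall x y : J, finite_type (Hom x y).

Definition FinitelyCocomplete (C : Category) : Type :=
  forall J : Category, finite_category J -> forall D : Functor J C, Colimit D.

Record Pushout (C : Category) (x y z : C) (f : Hom x y) (g : Hom x z) := {
  po : C;
  in1 : Hom y po;
  in2 : Hom z po;
  po_sq : in1 ∘ f = in2 ∘ g;
  copair : forall (w : C) (a : Hom y w) (b : Hom z w), a ∘ f = b ∘ g -> Hom po w;
  copair_in1 : forall w (a : Hom y w) (b : Hom z w) (e : a ∘ f = b ∘ g),
    copair e ∘ in1 = a;
  copair_in2 : forall w (a : Hom y w) (b : Hom z w) (e : a ∘ f = b ∘ g),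
    copair e ∘ in2 = b;
  copair_uniq : forall w (h h' : Hom po w),
    h ∘ in1 = h' ∘ in1 -> h ∘ in2 = h' ∘ in2 -> h = h'
}.

Inductive span_ob := span_mid | span_left | span_right.

Definition span_hom (a b : span_ob) : Type :=
  match a, b with
  | span_mid, _ | span_left, span_left | span_right, span_right => unit
  | _, _ => Empty_set
  end.

Program Definition span_category : Category :=
  {| Ob := span_ob; Hom := span_hom;
     idm := fun a => match a with span_mid | span_left | span_right => tt end;
     comp := fun a b c =>
       match a, b, c return span_hom b c -> span_hom a b -> span_hom a c with
       | span_mid, _, _ => fun _ _ => tt
       | span_left, span_left, _ => fun v _ => v
       | span_right, span_right, _ => fun v _ => v
       | span_left, _, _ | span_right, _, _ => fun _ u => match u with end
       end |}.
Next Obligation. by move: f; case: x; case: y => [] []. Qed.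
Next Obligation. by move: f; case: x; case: y => [] []. Qed.
Next Obligation.
by move: h g f; case: w; case: x; case: y; case: z => [] [] [] [].
Qed.

Lemma span_finite : finite_category span_category.
Proof.
split.
- by exists (span_mid :: span_left :: span_right :: nil); case; simpl; auto.
- by case; case; (exists (tt :: nil); case; left) || (exists nil; case).
Qed.

Section SpanPushout.
Context (C : Category) (x y z : C) (f : Hom x y) (g : Hom x z).

Definition span_fobj (a : span_category) : C :=
  match a with span_mid => x | span_left => y | span_right => z end.

Definition span_fmap (a b : span_category) :
    Hom a b -> Hom (span_fobj a) (span_fobj b) :=
  match a, b return span_hom a b -> Hom (span_fobj a) (span_fobj b) with
  | span_mid, span_left => fun _ => f
  | span_mid, span_right => fun _ => g
  | span_mid, span_mid => fun _ => idm x
  | span_left, span_left => fun _ => idm y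
  | span_right, span_right => fun _ => idm z
  | span_left, _ | span_right, _ => fun u => match u with end
  end.

Program Definition span_functor : Functor span_category C :=
  {| fobj := span_fobj; fmap := span_fmap |}.
Next Obligation. by case: x0. Qed.
Next Obligation.
by move: g0 f0; case: x0; case: y0; case: z0 => [] [] [] /=;
  rewrite ?comp_idl ?comp_idr.
Qed.

Program Definition span_cocone (w : C) (a : Hom y w) (b : Hom z w)
    (e : a ∘ f = b ∘ g) : Cocone span_functor w :=
  {| leg := fun j => match j return Hom (span_fobj j) w with
                     | span_mid => a ∘ f | span_left => a | span_right => b
                     end |}.
Next Obligation. by move: u; case: i; case: j => [] [] /=; rewrite ?comp_idr. Qed.

Program Definition pushout_of_colimit (c : Colimit span_functor) : Pushout f g :=
  {| po := colim c;
     in1 := colim_cocone c span_left;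
     in2 := colim_cocone c span_right;
     copair := fun w a b e => colim_desc c (span_cocone e) |}.
Next Obligation.
have /= -> := leg_nat (colim_cocone c) (tt : @Hom span_category span_mid span_left).
by have /= -> := leg_nat (colim_cocone c) (tt : @Hom span_category span_mid span_right).
Qed.
Next Obligation. exact: (colim_desc_leg c (span_cocone e) span_left). Qed.
Next Obligation. exact: (colim_desc_leg c (span_cocone e) span_right). Qed.
Next Obligation.
have E : (h' ∘ colim_cocone c span_left) ∘ f = (h' ∘ colim_cocone c span_right) ∘ g.
  have /= l := leg_nat (colim_cocone c) (tt : @Hom span_category span_mid span_left).
  have /= r := leg_nat (colim_cocone c) (tt : @Hom span_category span_mid span_right).
  by rewrite -!comp_assoc l r.
have m := leg_nat (colim_cocone c) (tt : @Hom span_category span_mid span_left).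
have e1 : h = colim_desc c (span_cocone E).
  by apply: colim_desc_uniq; case=> //=; rewrite -H -comp_assoc -m.
have e2 : h' = colim_desc c (span_cocone E).
  by apply: colim_desc_uniq; case=> //=; rewrite -comp_assoc -m.
exact: eq_trans e1 (eq_sym e2).
Qed.

End SpanPushout.

Definition pushout (C : Category) (FC : FinitelyCocomplete C)
    (x y z : C) (f : Hom x y) (g : Hom x z) : Pushout f g :=
  pushout_of_colimit (FC span_category span_finite (span_functor f g)).

Record SliceOb (C : Category) (z : C) := MkSlice { tot : C; arr : Hom tot z }.
Arguments MkSlice {C z tot} arr.

Record SliceHom (C : Category) (z : C) (A B : SliceOb z) := MkSliceHom {
  shom : Hom (tot A) (tot B);
  shom_comm : arr B ∘ shom = arr A
}.

Lemma slice_hom_eq (C : Category) (z : C) (A B : SliceOb z) (f g : SliceHom A B) :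
  shom f = shom g -> f = g.
Proof.
case: f => f Hf; case: g => g Hg /= e; subst g.
by rewrite (proof_irrelevance _ Hf Hg).
Qed.

Program Definition Slice (C : Category) (z : C) : Category :=
  {| Ob := SliceOb z;
     Hom := @SliceHom C z;
     idm := fun A => {| shom := idm (tot A) |};
     comp := fun A B D g f => {| shom := shom g ∘ shom f |} |}.
Next Obligation. exact: comp_idr. Qed.
Next Obligation. by rewrite comp_assoc !shom_comm. Qed.
Next Obligation. apply: slice_hom_eq; exact: comp_idl. Qed.
Next Obligation. apply: slice_hom_eq; exact: comp_idr. Qed.
Next Obligation. apply: slice_hom_eq; exact: comp_assoc. Qed.

Program Definition Sigma (C : Category) (x y : C) (u : Hom x y) :
    Functor (Slice x) (Slice y) :=
  {| fobj := fun A : Slice x => MkSlice (u ∘ arr A) : Slice y;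
     fmap := fun A B f => {| shom := shom f |} |}.
Next Obligation. by rewrite -comp_assoc shom_comm. Qed.
Next Obligation. exact: slice_hom_eq. Qed.
Next Obligation. exact: slice_hom_eq. Qed.

Record Terminal (C : Category) := {
  term : C;
  bang : forall x, Hom x term;
  bang_uniq : forall x (f g : Hom x term), f = g
}.

Record Pullback (C : Category) (x y z : C) (f : Hom x z) (g : Hom y z) := {
  pb : C;
  pr1 : Hom pb x;
  pr2 : Hom pb y;
  pb_sq : f ∘ pr1 = g ∘ pr2;
  pair : forall (w : C) (a : Hom w x) (b : Hom w y), f ∘ a = g ∘ b -> Hom w pb;
  pair_pr1 : forall w (a : Hom w x) (b : Hom w y) (e : f ∘ a = g ∘ b),
    pr1 ∘ pair e = a;
  pair_pr2 : forall w (a : Hom w x) (b : Hom w y) (e : f ∘ a = g ∘ b),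
    pr2 ∘ pair e = b;
  pair_uniq : forall w (h h' : Hom w pb),
    pr1 ∘ h = pr1 ∘ h' -> pr2 ∘ h = pr2 ∘ h' -> h = h'
}.

Definition HasPullbacks (C : Category) : Type :=
  forall (x y z : C) (f : Hom x z) (g : Hom y z), Pullback f g.

Program Definition pullback_functor (C : Category) (P : HasPullbacks C)
    (x y : C) (u : Hom x y) : Functor (Slice y) (Slice x) :=
  {| fobj := fun A : Slice y => MkSlice (pr1 (P _ _ _ u (arr A))) : Slice x;
     fmap := fun A B f =>
       {| shom := pair (P _ _ _ u (arr B))
                    (a := pr1 (P _ _ _ u (arr A)))
                    (b := shom f ∘ pr2 (P _ _ _ u (arr A))) _ |} |}.
Next Obligation. by rewrite comp_assoc shom_comm pb_sq. Qed.
Next Obligation. by rewrite pair_pr1. Qed.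
Next Obligation.
apply: slice_hom_eq; apply: pair_uniq => /=.
- by rewrite pair_pr1 comp_idr.
- by rewrite pair_pr2 comp_idl comp_idr.
Qed.
Next Obligation.
apply: slice_hom_eq; apply: pair_uniq => /=.
- by rewrite comp_assoc !pair_pr1.
- rewrite pair_pr2 [X in _ = X]comp_assoc pair_pr2.
  by rewrite -[X in _ = X]comp_assoc pair_pr2 comp_assoc.
Qed.

Program Definition sigma_adj (C : Category) (P : HasPullbacks C)
    (x y : C) (u : Hom x y) : Adjunction (Sigma u) (pullback_functor P u) :=
  {| adj_unit := {| nt := fun A : Slice x =>
       {| shom := pair (P _ _ _ u (u ∘ arr A)) (a := arr A) (b := idm (tot A)) _ |} |};
     adj_counit := {| nt := fun A : Slice y => {| shom := pr2 (P _ _ _ u (arr A)) |} |} |}.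
Next Obligation. by rewrite comp_idr. Qed.
Next Obligation. by rewrite pair_pr1. Qed.
Next Obligation.
apply: slice_hom_eq; apply: pair_uniq => /=.
- by rewrite !comp_assoc !pair_pr1 shom_comm.
- by rewrite !comp_assoc !pair_pr2 -comp_assoc pair_pr2 comp_idl comp_idr.
Qed.
Next Obligation. by rewrite pb_sq. Qed.
Next Obligation. by apply: slice_hom_eq => /=; rewrite pair_pr2. Qed.
Next Obligation. by apply: slice_hom_eq => /=; rewrite pair_pr2. Qed.
Next Obligation.
apply: slice_hom_eq; apply: pair_uniq => /=.
- by rewrite comp_assoc !pair_pr1 comp_idr.
- by rewrite comp_assoc pair_pr2 -comp_assoc pair_pr2 !comp_idr.
Qed.

(** The terminal object is part of the structure: closed types of the internal
    language, such as [Σ_{i:I} J], need products in [C]. *)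
Record LocallyCartesianClosed (C : Category) := {
  lcc_terminal : Terminal C;
  lcc_pullback : HasPullbacks C;
  Pi : forall (x y : C) (u : Hom x y), Functor (Slice x) (Slice y);
  pi_adj : forall (x y : C) (u : Hom x y),
    Adjunction (pullback_functor lcc_pullback u) (Pi u)
}.
Arguments Pi {C} l {x y} u.
Arguments pi_adj {C} l {x y} u.

Definition Pb (C : Category) (L : LocallyCartesianClosed C) (x y : C) (u : Hom x y) :
  Functor (Slice y) (Slice x) := pullback_functor (lcc_pullback L) u.
Arguments Pb {C} L {x y} u.

Definition sigma_counit (C : Category) (L : LocallyCartesianClosed C)
    (x y : C) (u : Hom x y) : NatTrans (Sigma u ∘F Pb L u) (id_functor (Slice y)) :=
  adj_counit (sigma_adj (lcc_pullback L) u).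
Arguments sigma_counit {C} L {x y} u.

Definition pi_counit (C : Category) (L : LocallyCartesianClosed C)
    (x y : C) (u : Hom x y) : NatTrans (Pb L u ∘F Pi L u) (id_functor (Slice x)) :=
  adj_counit (pi_adj L u).
Arguments pi_counit {C} L {x y} u.

Record PointedEndofunctor (C : Category) := {
  pe_functor :> Functor C C;
  pe_point : NatTrans (id_functor C) pe_functor
}.

Record PointedIso (C : Category) (P Q : PointedEndofunctor C) := {
  pi_hom : NatTrans P Q;
  pi_inv : NatTrans Q P;
  pi_hom_inv : forall x, pi_hom x ∘ pi_inv x = idm (Q x);
  pi_inv_hom : forall x, pi_inv x ∘ pi_hom x = idm (P x);
  pi_hom_point : forall x, pi_hom x ∘ pe_point P x = pe_point Q x
}.

(** The pushout of [Id <- S -> T] in endofunctors of [C/z], with the inclusion of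
    [Id] as point. It is computed pointwise, and pushouts in [C/z] are computed
    in [C], with the induced map to [z]. *)
Section PushoutPointed.
Context (C : Category) (FC : FinitelyCocomplete C) (z : C).
Context (S T : Functor (Slice z) (Slice z)).
Context (l : NatTrans S (id_functor (Slice z))) (r : NatTrans S T).

Definition pp_pushout (A : Slice z) : Pushout (shom (l A)) (shom (r A)) :=
  pushout FC (shom (l A)) (shom (r A)).

#[local] Opaque pp_pushout.

Lemma pp_arr_sq (A : Slice z) : arr A ∘ shom (l A) = arr (T A) ∘ shom (r A).
Proof. by rewrite !shom_comm. Qed.

Lemma pp_map_sq (A B : Slice z) (f : Hom A B) :
  (in1 (pp_pushout B) ∘ shom f) ∘ shom (l A) =
  (in2 (pp_pushout B) ∘ shom (fmap T f)) ∘ shom (r A).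
Proof.
have /(f_equal (@shom _ _ _ _)) /= e1 := nt_nat l f.
have /(f_equal (@shom _ _ _ _)) /= e2 := nt_nat r f.
by rewrite -!comp_assoc -e1 -e2 !comp_assoc (po_sq (pp_pushout B)).
Qed.

Program Definition pp_functor : Functor (Slice z) (Slice z) :=
  {| fobj := fun A : Slice z => MkSlice (copair (pp_pushout A) (pp_arr_sq A)) : Slice z;
     fmap := fun A B f => {| shom := copair (pp_pushout A) (pp_map_sq f) |} |}.
Next Obligation.
apply: (copair_uniq (p := pp_pushout A)).
- by rewrite -comp_assoc !copair_in1 comp_assoc copair_in1 shom_comm.
- by rewrite -comp_assoc !copair_in2 comp_assoc copair_in2 shom_comm.
Qed.
Next Obligation.
apply: slice_hom_eq; apply: (copair_uniq (p := pp_pushout x)) => /=.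
- by rewrite copair_in1 comp_idl comp_idr.
- by rewrite copair_in2 fmap_id comp_idl comp_idr.
Qed.
Next Obligation.
apply: slice_hom_eq; apply: (copair_uniq (p := pp_pushout x)) => /=.
- by rewrite copair_in1 -[X in _ = X]comp_assoc copair_in1 !comp_assoc copair_in1.
- rewrite copair_in2 -[X in _ = X]comp_assoc copair_in2 fmap_comp.
  by rewrite !comp_assoc copair_in2.
Qed.

Program Definition pushout_pointed : PointedEndofunctor (Slice z) :=
  {| pe_functor := pp_functor;
     pe_point := {| nt := fun A : Slice z => {| shom := in1 (pp_pushout A) |} |} |}.
Next Obligation. by rewrite copair_in1. Qed.
Next Obligation. by apply: slice_hom_eq => /=; rewrite copair_in1. Qed.

End PushoutPointed.

Record PolynomialWithReductions (C : Category) (Z : C) := {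
  pr_R : C; pr_X : C; pr_D : C;
  pr_k : Hom pr_R pr_X;
  pr_f : Hom pr_X pr_D;
  pr_g : Hom pr_D Z;
  pr_h : Hom pr_X Z;
  pr_eq : pr_g ∘ pr_f ∘ pr_k = pr_h ∘ pr_k
}.

Lemma counit3_nat (Z X R D : Category)
    (Sh : Functor X Z) (Hs : Functor Z X) (ch : NatTrans (Sh ∘F Hs) (id_functor Z))
    (Sk : Functor R X) (Ks : Functor X R) (ck : NatTrans (Sk ∘F Ks) (id_functor X))
    (Fs : Functor D X) (Pf : Functor X D) (cf : NatTrans (Fs ∘F Pf) (id_functor X))
    (A B : Z) (a : Hom A B) :
  ch B ∘ fmap Sh (ck (Hs B)) ∘ fmap Sh (fmap Sk (fmap Ks (cf (Hs B))))
    ∘ fmap (Sh ∘F (Sk ∘F (Ks ∘F (Fs ∘F (Pf ∘F Hs))))) a =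
  a ∘ (ch A ∘ fmap Sh (ck (Hs A)) ∘ fmap Sh (fmap Sk (fmap Ks (cf (Hs A))))).
Proof.
have /= e1 := nt_nat ch a.
have /= e2 := nt_nat ck (fmap Hs a).
have /= e3 := nt_nat cf (fmap Hs a).
have {}e2 := f_equal (fmap Sh) e2.
have {}e3 := f_equal (fun c => fmap Sh (fmap Sk (fmap Ks c))) e3.
rewrite /= !fmap_comp in e2 e3 *.
by rewrite -comp_assoc e3 !comp_assoc -e1 -[X in X ∘ _]comp_assoc e2 !comp_assoc.
Qed.

Lemma counit2_nat (Z X R D : Category)
    (Sg : Functor D Z) (Sf : Functor X D) (Fs : Functor D X)
    (cf : NatTrans (Sf ∘F Fs) (id_functor D))
    (Sk : Functor R X) (Ks : Functor X R) (ck : NatTrans (Sk ∘F Ks) (id_functor X))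
    (Sh : Functor X Z) (s : NatTrans (Sh ∘F Sk) (Sg ∘F (Sf ∘F Sk)))
    (A B : D) (b : Hom A B) :
  fmap Sg (cf B) ∘ fmap Sg (fmap Sf (ck (Fs B))) ∘ s (Ks (Fs B))
    ∘ fmap (Sh ∘F (Sk ∘F (Ks ∘F Fs))) b =
  fmap Sg b
    ∘ (fmap Sg (cf A) ∘ fmap Sg (fmap Sf (ck (Fs A))) ∘ s (Ks (Fs A))).
Proof.
have /= e1 := nt_nat cf b.
have /= e2 := nt_nat ck (fmap Fs b).
have /= e3 := nt_nat s (fmap Ks (fmap Fs b)).
have {}e1 := f_equal (fmap Sg) e1.
have {}e2 := f_equal (fun c => fmap Sg (fmap Sf c)) e2.
rewrite /= !fmap_comp in e1 e2 *.
by rewrite -comp_assoc e3 !comp_assoc -e1 -[X in X ∘ _]comp_assoc e2 !comp_assoc.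
Qed.

Section PolyRedFunctor.
Context (C : Category) (FC : FinitelyCocomplete C) (L : LocallyCartesianClosed C).
Context (Z : C) (p : PolynomialWithReductions Z).
Let k := pr_k p.
Let f := pr_f p.
Let g := pr_g p.
Let h := pr_h p.

Definition poly_src : Functor (Slice Z) (Slice Z) :=
  Sigma h ∘F (Sigma k ∘F (Pb L k ∘F (Pb L f ∘F (Pi L f ∘F Pb L h)))).

Definition poly_tgt : Functor (Slice Z) (Slice Z) :=
  Sigma g ∘F (Pi L f ∘F Pb L h).

(** The identification [Σ_h Σ_k = Σ_g Σ_f Σ_k]; it is the identity in [C]. *)
Program Definition sigma_eq : NatTrans (Sigma h ∘F Sigma k)
    (Sigma g ∘F (Sigma f ∘F Sigma k)) :=
  {| nt := fun A : Slice (pr_R p) => {| shom := idm (tot A) |} |}.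
Next Obligation.
by rewrite comp_idr !comp_assoc -[h ∘ k](pr_eq p).
Qed.
Next Obligation. by apply: slice_hom_eq; rewrite /= comp_idl comp_idr. Qed.

Definition poly_left_map (A : Slice Z) : Hom (poly_src A) A :=
  sigma_counit L h A
  ∘ fmap (Sigma h) (sigma_counit L k (Pb L h A))
  ∘ fmap (Sigma h) (fmap (Sigma k) (fmap (Pb L k) (pi_counit L f (Pb L h A)))).

Lemma poly_left_nat (A B : Slice Z) (a : Hom A B) :
  poly_left_map B ∘ fmap poly_src a = a ∘ poly_left_map A.
Proof. exact: counit3_nat. Qed.

Definition poly_left : NatTrans poly_src (id_functor (Slice Z)) :=
  {| nt := poly_left_map : forall A, Hom _ (id_functor (Slice Z) A);
     nt_nat := poly_left_nat |}.

Definition poly_right_map (A : Slice Z) : Hom (poly_src A) (poly_tgt A) :=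
  fmap (Sigma g) (sigma_counit L f (Pi L f (Pb L h A)))
  ∘ fmap (Sigma g) (fmap (Sigma f)
      (sigma_counit L k (Pb L f (Pi L f (Pb L h A)))))
  ∘ sigma_eq (Pb L k (Pb L f (Pi L f (Pb L h A)))).

Lemma poly_right_nat (A B : Slice Z) (a : Hom A B) :
  poly_right_map B ∘ fmap poly_src a = fmap poly_tgt a ∘ poly_right_map A.
Proof.
exact: (counit2_nat (sigma_counit L f) (sigma_counit L k) sigma_eq
  (fmap (Pi L f) (fmap (Pb L h) a))).
Qed.

Definition poly_right : NatTrans poly_src poly_tgt :=
  {| nt := poly_right_map; nt_nat := poly_right_nat |}.

Definition poly_pointed : PointedEndofunctor (Slice Z) :=
  pushout_pointed FC poly_left poly_right.

End PolyRedFunctor.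

Definition pointed_polynomial (C : Category) (FC : FinitelyCocomplete C)
    (L : LocallyCartesianClosed C) (Z : C) (F : PointedEndofunctor (Slice Z)) : Prop :=
  exists p : PolynomialWithReductions Z, inhabited (PointedIso (poly_pointed FC L p) F).

Section Evaluation.
Context (C : Category) (L : LocallyCartesianClosed C).

Notation pbk u v := (lcc_pullback L u v).

(** The value at [w : T -> x] of an element [s] of [Π_u A] over [u ∘ w]. *)
Definition pi_eval (x y : C) (u : Hom x y) (A : Slice x) (T : C)
    (w : Hom T x) (s : Hom T (tot (Pi L u A))) (e : u ∘ w = arr (Pi L u A) ∘ s) :
    Hom T (tot A) :=
  shom (pi_counit L u A) ∘ pair (pbk u (arr (Pi L u A))) e.

Lemma pi_eval_arr (x y : C) (u : Hom x y) (A : Slice x) (T : C)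
    (w : Hom T x) (s : Hom T (tot (Pi L u A))) (e : u ∘ w = arr (Pi L u A) ∘ s) :
  arr A ∘ pi_eval e = w.
Proof.
rewrite /pi_eval comp_assoc (shom_comm (pi_counit L u A)).
exact: (pair_pr1 (pbk u (arr (Pi L u A))) e).
Qed.

Lemma pi_eval_nat (x y : C) (u : Hom x y) (A B : Slice x) (a : Hom A B) (S T : C)
    (v : Hom S T)
    (w : Hom T x) (s : Hom T (tot (Pi L u B))) (e : u ∘ w = arr (Pi L u B) ∘ s)
    (w' : Hom S x) (s' : Hom S (tot (Pi L u A))) (e' : u ∘ w' = arr (Pi L u A) ∘ s') :
  w ∘ v = w' -> s ∘ v = shom (fmap (Pi L u) a) ∘ s' ->
  pi_eval e ∘ v = shom a ∘ pi_eval e'.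
Proof.
move=> ew es; rewrite /pi_eval.
have /(f_equal (@shom _ _ _ _)) n := nt_nat (pi_counit L u) a.
have {}n : shom (pi_counit L u B) ∘ shom (fmap (Pb L u) (fmap (Pi L u) a)) =
  shom a ∘ shom (pi_counit L u A) := n.
rewrite comp_assoc -n -!comp_assoc; congr (_ ∘ _).
apply: (pair_uniq (p := pbk u (arr (Pi L u B)))); rewrite !comp_assoc /=.
- by rewrite !pair_pr1.
- by rewrite !pair_pr2 es -comp_assoc pair_pr2.
Qed.

(** The exponential [B^A] in [C/z], as a functor of [B]. *)
Definition exp_functor (z : C) (A : Slice z) : Functor (Slice z) (Slice z) :=
  Pi L (arr A) ∘F Pb L (arr A).

Definition exp_eval (z : C) (A B : Slice z) (T : C)
    (w : Hom T (tot A)) (s : Hom T (tot (exp_functor A B)))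
    (e : arr A ∘ w = arr (exp_functor A B) ∘ s) : Hom T (tot B) :=
  pr2 (pbk (arr A) (arr B)) ∘ pi_eval (u := arr A) (A := Pb L (arr A) B) e.

Lemma exp_eval_arr (z : C) (A B : Slice z) (T : C)
    (w : Hom T (tot A)) (s : Hom T (tot (exp_functor A B)))
    (e : arr A ∘ w = arr (exp_functor A B) ∘ s) :
  arr B ∘ exp_eval e = arr A ∘ w.
Proof.
rewrite /exp_eval comp_assoc -pb_sq -comp_assoc.
by rewrite (pi_eval_arr (A := Pb L (arr A) B) e).
Qed.

Lemma exp_eval_nat (z : C) (A B B' : Slice z) (b : Hom B B') (S T : C)
    (v : Hom S T)
    (w : Hom T (tot A)) (s : Hom T (tot (exp_functor A B')))
    (e : arr A ∘ w = arr (exp_functor A B') ∘ s)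
    (w' : Hom S (tot A)) (s' : Hom S (tot (exp_functor A B)))
    (e' : arr A ∘ w' = arr (exp_functor A B) ∘ s') :
  w ∘ v = w' -> s ∘ v = shom (fmap (exp_functor A) b) ∘ s' ->
  exp_eval e ∘ v = shom b ∘ exp_eval e'.
Proof.
move=> ew es; rewrite /exp_eval -comp_assoc.
rewrite (pi_eval_nat (a := fmap (Pb L (arr A)) b) e e' ew es).
by rewrite !comp_assoc /= pair_pr2.
Qed.

End Evaluation.

Section Restrict.
Context (C : Category) (L : LocallyCartesianClosed C) (I : C).

Notation pbk u v := (lcc_pullback L u v).

Lemma restrict_sq (K K' : C) (s : Hom K I) (s' : Hom K' I) (t : Hom K K')
    (e : s' ∘ t = s) (W : Slice I) :
  s' ∘ (t ∘ pr1 (pbk s (arr W))) = arr W ∘ pr2 (pbk s (arr W)).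
Proof. by rewrite -pb_sq comp_assoc e. Qed.

Definition restrict (K K' : C) (s : Hom K I) (s' : Hom K' I) (t : Hom K K')
    (e : s' ∘ t = s) (W : Slice I) : Hom (tot (Pb L s W)) (tot (Pb L s' W)) :=
  pair (pbk s' (arr W)) (restrict_sq e W).

Lemma restrict_pr1 (K K' : C) (s : Hom K I) (s' : Hom K' I) (t : Hom K K')
    (e : s' ∘ t = s) (W : Slice I) :
  pr1 (pbk s' (arr W)) ∘ restrict e W = t ∘ pr1 (pbk s (arr W)).
Proof. exact: pair_pr1. Qed.

Lemma restrict_pr2 (K K' : C) (s : Hom K I) (s' : Hom K' I) (t : Hom K K')
    (e : s' ∘ t = s) (W : Slice I) :
  pr2 (pbk s' (arr W)) ∘ restrict e W = pr2 (pbk s (arr W)).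
Proof. exact: pair_pr2. Qed.

Lemma restrict_id (K : C) (s : Hom K I) (t : Hom K K) (e : s ∘ t = s) (W : Slice I) :
  t = idm K -> restrict e W = idm (tot (Pb L s W)).
Proof.
move=> et; apply: (pair_uniq (p := pbk s (arr W))).
- by rewrite restrict_pr1 et comp_idl comp_idr.
- by rewrite restrict_pr2 comp_idr.
Qed.

Lemma restrict_comp (K1 K2 K3 : C) (s1 : Hom K1 I) (s2 : Hom K2 I) (s3 : Hom K3 I)
    (t12 : Hom K1 K2) (t23 : Hom K2 K3) (t13 : Hom K1 K3)
    (e12 : s2 ∘ t12 = s1) (e23 : s3 ∘ t23 = s2) (e13 : s3 ∘ t13 = s1) (W : Slice I) :
  t13 = t23 ∘ t12 -> restrict e13 W = restrict e23 W ∘ restrict e12 W.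
Proof.
move=> et; apply: (pair_uniq (p := pbk s3 (arr W))); rewrite [X in _ = X]comp_assoc.
- by rewrite !restrict_pr1 -[X in _ = X]comp_assoc restrict_pr1 et comp_assoc.
- by rewrite !restrict_pr2.
Qed.

Lemma restrict_nat (K K' : C) (s : Hom K I) (s' : Hom K' I) (t : Hom K K')
    (e : s' ∘ t = s) (W W' : Slice I) (m : Hom W W') :
  shom (fmap (Pb L s') m) ∘ restrict e W = restrict e W' ∘ shom (fmap (Pb L s) m).
Proof.
apply: (pair_uniq (p := pbk s' (arr W'))); rewrite !comp_assoc.
- by rewrite restrict_pr1 /= pair_pr1 -comp_assoc pair_pr1 restrict_pr1.
- by rewrite restrict_pr2 /= pair_pr2 -comp_assoc pair_pr2 restrict_pr2.
Qed.

End Restrict.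

(** A map [f : X -> Y] in [C/J] is given by [Y : Slice J] and
    [f : Slice (tot Y)]: the map [X -> J] is then forced. *)
Record LiftingFamily (C : Category) (L : LocallyCartesianClosed C)
    (I : C) (U V : Slice I) (m : Hom U V)
    (J : C) (Y : Slice J) (f : Slice (tot Y)) (K : C) := {
  lf_idx : Hom K I;
  lf_base : Hom K J;
  lf_top : Hom (tot (Pb L lf_idx U)) (tot f);
  lf_bot : Hom (tot (Pb L lf_idx V)) (tot Y);
  lf_sq : arr f ∘ lf_top = lf_bot ∘ shom (fmap (Pb L lf_idx) m);
  lf_sq_base : arr Y ∘ lf_bot = lf_base ∘ arr (Pb L lf_idx V)
}.

Section UniversalFamily.
Context (C : Category) (L : LocallyCartesianClosed C).
Context (I : C) (U V : Slice I) (m : Hom U V) (J : C) (Y : Slice J).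

Notation pbk u v := (lcc_pullback L u v).

(** [Σ_{i:I} Σ_{j:J} 1] *)
Definition uf_IJ : Pullback (bang (lcc_terminal L) I) (bang (lcc_terminal L) J) :=
  pbk (bang (lcc_terminal L) I) (bang (lcc_terminal L) J).

Definition uf_V : Slice (pb uf_IJ) := Pb L (pr1 uf_IJ) V.
Definition uf_Y : Slice (pb uf_IJ) := Pb L (pr2 uf_IJ) Y.

(** [Σ_{i:I} Σ_{j:J} (V(i) -> Y(j))] *)
Definition uf_B : Slice (pb uf_IJ) := exp_functor L uf_V uf_Y.

(** [Σ_{i:I} Σ_{j:J} Σ_{β:V(i)->Y(j)} V(i)] *)
Definition uf_W : Pullback (arr uf_V) (arr uf_B) := pbk (arr uf_V) (arr uf_B).

(** [(i, j, β, v) |-> v] *)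
Definition uf_v : Hom (pb uf_W) (tot V) :=
  pr2 (pbk (pr1 uf_IJ) (arr V)) ∘ pr1 uf_W.

(** [(i, j, β, v) |-> β(v)] *)
Definition uf_ev : Hom (pb uf_W) (tot Y) :=
  pr2 (pbk (pr2 uf_IJ) (arr Y))
  ∘ exp_eval (A := uf_V) (B := uf_Y) (pb_sq uf_W).

(** [U(i, v)] over [(i, j, β, v)] *)
Definition uf_U : Slice (pb uf_W) := Pb L uf_v (MkSlice (shom m) : Slice (tot V)).

(** [U(i, v) -> X(j, β(v))] over [(i, j, β, v)] *)
Definition uf_fill : Functor (Slice (tot Y)) (Slice (pb uf_W)) :=
  exp_functor L uf_U ∘F Pb L uf_ev.

(** [Π_{v:V(i)} (U(i, v) -> X(j, β(v)))] over [(i, j, β)], as a functor of [X] *)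
Definition uf_K : Functor (Slice (tot Y)) (Slice (tot uf_B)) :=
  Pi L (pr2 uf_W) ∘F uf_fill.

Definition uf_idx (f : Slice (tot Y)) : Hom (tot (uf_K f)) I :=
  pr1 uf_IJ ∘ arr uf_B ∘ arr (uf_K f).

Definition uf_base (f : Slice (tot Y)) : Hom (tot (uf_K f)) J :=
  pr2 uf_IJ ∘ arr uf_B ∘ arr (uf_K f).

Section AtMap.
Context (f : Slice (tot Y)).

Notation sV := (pbk (uf_idx f) (arr V)).
Notation sU := (pbk (uf_idx f) (arr U)).
Notation sm := (shom (fmap (Pb L (uf_idx f)) m)).

Lemma uf_toV_sq :
  pr1 uf_IJ ∘ (arr uf_B ∘ arr (uf_K f) ∘ pr1 sV) = arr V ∘ pr2 sV.
Proof. by rewrite !comp_assoc pb_sq. Qed.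

Definition uf_toV : Hom (pb sV) (tot uf_V) := pair (pbk (pr1 uf_IJ) (arr V)) uf_toV_sq.

Lemma uf_toW_sq : arr uf_V ∘ uf_toV = arr uf_B ∘ (arr (uf_K f) ∘ pr1 sV).
Proof.
by rewrite comp_assoc; exact: (pair_pr1 (pbk (pr1 uf_IJ) (arr V)) uf_toV_sq).
Qed.

(** [σ^*(V) -> W], [((i, j, β, φ), v) |-> (i, j, β, v)] *)
Definition uf_toW : Hom (pb sV) (pb uf_W) := pair uf_W uf_toW_sq.

Definition uf_bot : Hom (tot (Pb L (uf_idx f) V)) (tot Y) := uf_ev ∘ uf_toW.

Lemma uf_sq_base : arr Y ∘ uf_bot = uf_base f ∘ arr (Pb L (uf_idx f) V).
Proof.
have ev : arr Y ∘ uf_ev = pr2 uf_IJ ∘ arr uf_B ∘ pr2 uf_W.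
  rewrite /uf_ev comp_assoc -pb_sq -comp_assoc.
  by rewrite (exp_eval_arr (B := uf_Y) (pb_sq uf_W)) (pb_sq uf_W) comp_assoc.
rewrite /uf_bot comp_assoc ev -comp_assoc /uf_toW pair_pr2.
by rewrite /uf_base !comp_assoc.
Qed.

Lemma uf_elt_sq : uf_v ∘ (uf_toW ∘ sm) = shom m ∘ pr2 sU.
Proof.
rewrite /uf_v -!comp_assoc [pr1 uf_W ∘ _]comp_assoc /uf_toW pair_pr1.
by rewrite comp_assoc /uf_toV pair_pr2 /= pair_pr2.
Qed.

(** [σ^*(U) -> Σ_W U], [((i, j, β, φ), v, u) |-> (i, j, β, v, u)] *)
Definition uf_elt : Hom (pb sU) (tot uf_U) := pair (pbk uf_v (shom m)) uf_elt_sq.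

Lemma uf_fun_sq : pr2 uf_W ∘ (uf_toW ∘ sm) = arr (uf_K f) ∘ pr1 sU.
Proof.
by rewrite comp_assoc /uf_toW pair_pr2 -comp_assoc /= pair_pr1.
Qed.

(** [((i, j, β, φ), v, u) |-> φ(v)] *)
Definition uf_fun : Hom (pb sU) (tot (uf_fill f)) :=
  pi_eval (L := L) (u := pr2 uf_W) (A := uf_fill f) uf_fun_sq.

Lemma uf_app_sq : arr uf_U ∘ uf_elt = arr (uf_fill f) ∘ uf_fun.
Proof.
by rewrite /uf_fun pi_eval_arr; exact: (pair_pr1 (pbk uf_v (shom m)) uf_elt_sq).
Qed.

(** [((i, j, β, φ), v, u) |-> φ(v)(u)] *)
Definition uf_top : Hom (tot (Pb L (uf_idx f) U)) (tot f) :=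
  pr2 (pbk uf_ev (arr f))
  ∘ exp_eval (L := L) (A := uf_U) (B := Pb L uf_ev f) uf_app_sq.

Lemma uf_sq : arr f ∘ uf_top = uf_bot ∘ sm.
Proof.
rewrite /uf_top comp_assoc -pb_sq -comp_assoc.
rewrite (exp_eval_arr (B := Pb L uf_ev f) uf_app_sq).
have -> : arr uf_U ∘ uf_elt = uf_toW ∘ sm :=
  pair_pr1 (pbk uf_v (shom m)) uf_elt_sq.
exact: comp_assoc.
Qed.

Definition universal_family : LiftingFamily L m f (tot (uf_K f)) :=
  {| lf_idx := uf_idx f;
     lf_base := uf_base f;
     lf_top := uf_top;
     lf_bot := uf_bot;
     lf_sq := uf_sq;
     lf_sq_base := uf_sq_base |}.

End AtMap.

Section Step1Map.
Context (f f' : Slice (tot Y)) (a : Hom f f').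

Lemma uf_idx_map : uf_idx f' ∘ shom (fmap uf_K a) = uf_idx f.
Proof. by rewrite /uf_idx -comp_assoc (shom_comm (fmap uf_K a)). Qed.

Lemma uf_toW_map : uf_toW f' ∘ restrict L uf_idx_map V = uf_toW f.
Proof.
have kE : arr (uf_K f') ∘ shom (fmap uf_K a) = arr (uf_K f) :=
  shom_comm (fmap uf_K a).
have p1 := restrict_pr1 L uf_idx_map V.
have p2 := restrict_pr2 L uf_idx_map V.
have w1 g := pair_pr1 uf_W (uf_toW_sq g).
have w2 g := pair_pr2 uf_W (uf_toW_sq g).
have v1 g := pair_pr1 (pbk (pr1 uf_IJ) (arr V)) (uf_toV_sq g).
have v2 g := pair_pr2 (pbk (pr1 uf_IJ) (arr V)) (uf_toV_sq g).
apply: (pair_uniq (p := uf_W)).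
- rewrite comp_assoc; apply: eq_trans (f_equal (fun c => c ∘ _) (w1 f')) _.
  apply: eq_trans (eq_sym (w1 f)).
  apply: (pair_uniq (p := pbk (pr1 uf_IJ) (arr V))).
  + rewrite comp_assoc; apply: eq_trans (f_equal (fun c => c ∘ _) (v1 f')) _.
    apply: eq_trans (eq_sym (v1 f)).
    by rewrite -comp_assoc p1 comp_assoc -[_ ∘ _ ∘ shom _]comp_assoc kE.
  + rewrite comp_assoc; apply: eq_trans (f_equal (fun c => c ∘ _) (v2 f')) _.
    exact: eq_trans p2 (eq_sym (v2 f)).
- rewrite comp_assoc; apply: eq_trans (f_equal (fun c => c ∘ _) (w2 f')) _.
  by apply: eq_trans (eq_sym (w2 f)); rewrite -comp_assoc p1 comp_assoc kE.
Qed.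

Lemma uf_bot_map : uf_bot f' ∘ restrict L uf_idx_map V = uf_bot f.
Proof. by rewrite /uf_bot -comp_assoc uf_toW_map. Qed.

Lemma uf_top_map : uf_top f' ∘ restrict L uf_idx_map U = shom a ∘ uf_top f.
Proof.
have tE : uf_toW f' ∘ shom (fmap (Pb L (uf_idx f')) m) ∘ restrict L uf_idx_map U =
    uf_toW f ∘ shom (fmap (Pb L (uf_idx f)) m).
  by rewrite -comp_assoc restrict_nat comp_assoc uf_toW_map.
have p1 := restrict_pr1 L uf_idx_map U.
have p2 := restrict_pr2 L uf_idx_map U.
have e1 g := pair_pr1 (pbk uf_v (shom m)) (uf_elt_sq g).
have e2 g := pair_pr2 (pbk uf_v (shom m)) (uf_elt_sq g).
have eE : uf_elt f' ∘ restrict L uf_idx_map U = uf_elt f.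
  apply: (pair_uniq (p := pbk uf_v (shom m))); rewrite comp_assoc.
    apply: eq_trans (f_equal (fun c => c ∘ _) (e1 f')) _.
    exact: eq_trans tE (eq_sym (e1 f)).
  apply: eq_trans (f_equal (fun c => c ∘ _) (e2 f')) _.
  exact: eq_trans p2 (eq_sym (e2 f)).
have fE : uf_fun f' ∘ restrict L uf_idx_map U = shom (fmap uf_fill a) ∘ uf_fun f.
  exact: (pi_eval_nat (a := fmap uf_fill a) (uf_fun_sq f') (uf_fun_sq f) tE p1).
rewrite /uf_top -comp_assoc.
rewrite (exp_eval_nat (b := fmap (Pb L uf_ev) a) (uf_app_sq f') (uf_app_sq f) eE fE).
rewrite comp_assoc.
have n : pr2 (pbk uf_ev (arr f')) ∘ shom (fmap (Pb L uf_ev) a) =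
    shom a ∘ pr2 (pbk uf_ev (arr f)) by exact: pair_pr2.
apply: eq_trans (f_equal (fun c => c ∘ _) n) _.
exact: eq_sym (comp_assoc _ _ _).
Qed.

End Step1Map.

(** [f |-> (σ^*(V) -> Y)] *)
Definition step1_V : Functor (Slice (tot Y)) (Slice (tot Y)).
Proof.
unshelve refine
  {| fobj := fun f : Slice (tot Y) =>
       MkSlice (lf_bot (universal_family f)) : Slice (tot Y);
     fmap := fun f f' a =>
       MkSliceHom (A := MkSlice (uf_bot f)) (B := MkSlice (uf_bot f')) (uf_bot_map a) |}.
- abstract by move=> f; apply: slice_hom_eq; apply: restrict_id; rewrite fmap_id.
- abstract by move=> f f' f'' b a; apply: slice_hom_eq; apply: restrict_comp;
    rewrite fmap_comp.
Defined.

Lemma step1_U_map (f f' : Slice (tot Y)) (a : Hom f f') :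
  arr f' ∘ uf_top f' ∘ restrict L (uf_idx_map a) U = arr f ∘ uf_top f.
Proof. by rewrite -comp_assoc uf_top_map comp_assoc shom_comm. Qed.

(** [f |-> (σ^*(U) -> X -> Y)] *)
Definition step1_U : Functor (Slice (tot Y)) (Slice (tot Y)).
Proof.
unshelve refine
  {| fobj := fun f : Slice (tot Y) =>
       MkSlice (arr f ∘ lf_top (universal_family f)) : Slice (tot Y);
     fmap := fun f f' a =>
       MkSliceHom (A := MkSlice (arr f ∘ uf_top f)) (B := MkSlice (arr f' ∘ uf_top f'))
         (step1_U_map a) |}.
- abstract by move=> f; apply: slice_hom_eq; apply: restrict_id; rewrite fmap_id.
- abstract by move=> f f' f'' b a; apply: slice_hom_eq; apply: restrict_comp;
    rewrite fmap_comp.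
Defined.

Definition step1_left : NatTrans step1_U (id_functor (Slice (tot Y))).
Proof.
unshelve refine (@Build_NatTrans _ _ step1_U (id_functor (Slice (tot Y)))
  (fun f => MkSliceHom (A := step1_U f) (B := f)
     (shom := lf_top (universal_family f)) eq_refl) _).
abstract by move=> f f' a; apply: slice_hom_eq; apply: uf_top_map.
Defined.

Definition step1_right : NatTrans step1_U step1_V.
Proof.
unshelve refine (@Build_NatTrans _ _ step1_U step1_V
  (fun f => MkSliceHom (A := step1_U f) (B := step1_V f)
     (shom := shom (fmap (Pb L (lf_idx (universal_family f))) m))
     (eq_sym (lf_sq (universal_family f)))) _).
abstract by move=> f f' a; apply: slice_hom_eq; apply: restrict_nat.
Defined.

Definition step1 (FC : FinitelyCocomplete C) : PointedEndofunctor (Slice (tot Y)) :=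
  pushout_pointed FC step1_left step1_right.

End UniversalFamily.

Arguments step1 {C} L {I U V} m {J} Y FC.

(* Main.v *)
From Stdlib Require Import ssreflect.
Require Import Defs.

(** Write [B] for the object of triples [(i, j, β)] with [β : V(i) -> Y(j)], [W -> B]
    for the family of the [V(i)] and [E -> W] for the family of the [U(i, v)]; so [E]
    consists of the [(i, j, β, v, u)]. A lifting problem with underlying [(i, j, β)]
    is a choice of an element of [X(j, β(v))] for all [(v, u)]. Thus the index [K f]
    of the universal family is, as a functor of [f], the functor [Π_(E -> B)] after
    pulling back along [E -> Y], [(i, j, β, v, u) |-> β(v)]. Step 1 is the pushout of
    [f] and [K f ×_B W], the latter over [Y] by [β(v)], along [K f ×_B E], with
    evaluation as the left leg.

    The right foot is polynomial in [f]: by Beck-Chevalley [K f ×_B W] is the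
    product along the projection [W ×_B E -> W] of the pullback of [f] along
    [(v, (v', u)) |-> β(v')]. Hence the polynomial has [D = W], [X = W ×_B E] and
    [R = E], where [k] is the diagonal [(v, u) |-> (v, (v, u))], on which [g f] and
    [h] agree because [v = v'] there. The apex of its span is then [K f ×_B W]
    pulled back along [E -> W], which is [K f ×_B E], and its left leg evaluates at
    the diagonal point, that is at [(v, u)].

    The comparison is carried by universal properties: [SectionsAlong] expresses
    that a functor is of the form [Π_e q^*]; [uf_K_sections] and [poly_sections]
    prove this for the two functors involved; [sections_span_iso] is the argument above
    for arbitrary functors of sections; [uf_sV_pullback], [uf_sU_pullback] and
    [poly_src_pullback] identify the feet and apexes as the pullbacks it needs. *)

Set Implicit Arguments.
Unset Strict Implicit.
Unset Printing Implicit Defensive.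

(** * Functors of sections *)

(** Data exhibiting [F] as [Π_e q^*], by generalized elements: an element of
    [F A] over [b : T -> B] is a family of elements of [A], lying over [q], that is
    indexed by the fibres of [e] above [b]. Working with this universal property
    rather than with chosen functors makes [Π] along a composite, iterated [Π]
    and pulled back [Π] directly comparable, with no coherence isomorphism to
    carry along. [sec_ev_nat] is naturality in the stage and in [A] at once. *)
Record SectionsAlong (C : Category) (L : LocallyCartesianClosed C)
    (E B Y : C) (e : Hom E B) (q : Hom E Y)
    (F : Functor (Slice Y) (Slice B)) := {
  sec_ev : forall (A : Slice Y) (T : C) (w : Hom T E) (s : Hom T (tot (F A))),
    e ∘ w = arr (F A) ∘ s -> Hom T (tot A);
  sec_ev_arr : forall (A : Slice Y) (T : C) (w : Hom T E) (s : Hom T (tot (F A)))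
    (c : e ∘ w = arr (F A) ∘ s), arr A ∘ sec_ev c = q ∘ w;
  sec_ev_nat : forall (A A' : Slice Y) (a : Hom A A') (S T : C) (v : Hom S T)
    (w : Hom T E) (s : Hom T (tot (F A'))) (c : e ∘ w = arr (F A') ∘ s)
    (w' : Hom S E) (s' : Hom S (tot (F A))) (c' : e ∘ w' = arr (F A) ∘ s'),
    w ∘ v = w' -> s ∘ v = shom (fmap F a) ∘ s' ->
    sec_ev c ∘ v = shom a ∘ sec_ev c';
  sec_curry : forall (A : Slice Y) (T : C) (b : Hom T B)
    (a : Hom (pb (lcc_pullback L e b)) (tot A)),
    arr A ∘ a = q ∘ pr1 (lcc_pullback L e b) -> Hom T (tot (F A));
  sec_curry_arr : forall (A : Slice Y) (T : C) (b : Hom T B)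
    (a : Hom (pb (lcc_pullback L e b)) (tot A))
    (c : arr A ∘ a = q ∘ pr1 (lcc_pullback L e b)),
    arr (F A) ∘ sec_curry c = b;
  sec_beta : forall (A : Slice Y) (T : C) (b : Hom T B)
    (a : Hom (pb (lcc_pullback L e b)) (tot A))
    (c : arr A ∘ a = q ∘ pr1 (lcc_pullback L e b))
    (S : C) (t : Hom S (pb (lcc_pullback L e b)))
    (w : Hom S E) (s : Hom S (tot (F A))) (c' : e ∘ w = arr (F A) ∘ s),
    pr1 (lcc_pullback L e b) ∘ t = w ->
    sec_curry c ∘ (pr2 (lcc_pullback L e b) ∘ t) = s ->
    sec_ev c' = a ∘ t;
  sec_ext : forall (A : Slice Y) (T : C) (s s' : Hom T (tot (F A))),
    arr (F A) ∘ s = arr (F A) ∘ s' ->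
    (forall (S : C) (v : Hom S T) (w : Hom S E)
       (c : e ∘ w = arr (F A) ∘ (s ∘ v)) (c' : e ∘ w = arr (F A) ∘ (s' ∘ v)),
       sec_ev c = sec_ev c') ->
    s = s'
}.
Arguments sec_ext {C L E B Y e q F} sF {A T s s'} : rename.
Arguments sec_beta {C L E B Y e q F} sF {A T b a c S t w s} c' : rename.

Section SectionsTheory.
Context (C : Category) (L : LocallyCartesianClosed C).

Notation pbk u v := (lcc_pullback L u v).

Lemma sec_ev_sub (E B Y : C) (e : Hom E B) (q : Hom E Y)
    (F : Functor (Slice Y) (Slice B)) (sF : SectionsAlong L e q F)
    (A : Slice Y) (S T : C) (v : Hom S T)
    (w : Hom T E) (s : Hom T (tot (F A))) (c : e ∘ w = arr (F A) ∘ s)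
    (w' : Hom S E) (s' : Hom S (tot (F A))) (c' : e ∘ w' = arr (F A) ∘ s') :
  w ∘ v = w' -> s ∘ v = s' -> sec_ev sF c ∘ v = sec_ev sF c'.
Proof.
move=> ew es.
have es' : s ∘ v = shom (fmap F (idm A)) ∘ s' by rewrite fmap_id es /= comp_idl.
by rewrite (sec_ev_nat sF c c' ew es') /= comp_idl.
Qed.

Lemma sec_ev_eq (E B Y : C) (e : Hom E B) (q : Hom E Y)
    (F : Functor (Slice Y) (Slice B)) (sF : SectionsAlong L e q F)
    (A : Slice Y) (T : C)
    (w w' : Hom T E) (s s' : Hom T (tot (F A))) (c : e ∘ w = arr (F A) ∘ s)
    (c' : e ∘ w' = arr (F A) ∘ s') :
  w = w' -> s = s' -> sec_ev sF c = sec_ev sF c'.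
Proof.
by move=> ew es; rewrite -[LHS]comp_idr; apply: sec_ev_sub; rewrite comp_idr.
Qed.

Lemma sec_ev_map (E B Y : C) (e : Hom E B) (q : Hom E Y)
    (F : Functor (Slice Y) (Slice B)) (sF : SectionsAlong L e q F)
    (A A' : Slice Y) (a : Hom A A') (T : C)
    (w w' : Hom T E) (s : Hom T (tot (F A'))) (c : e ∘ w = arr (F A') ∘ s)
    (s' : Hom T (tot (F A))) (c' : e ∘ w' = arr (F A) ∘ s') :
  w = w' -> s = shom (fmap F a) ∘ s' -> sec_ev sF c = shom a ∘ sec_ev sF c'.
Proof.
move=> ew es; rewrite -[LHS]comp_idr.
by apply: (sec_ev_nat sF c c'); rewrite comp_idr.
Qed.

Section PiSections.
Context (x y : C) (u : Hom x y).

Definition pi_curry (A : Slice x) (T : C) (b : Hom T y)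
    (a : Hom (pb (pbk u b)) (tot A)) (c : arr A ∘ a = pr1 (pbk u b)) :
    Hom (MkSlice b : Slice y) (Pi L u A) :=
  fmap (Pi L u) (MkSliceHom (A := Pb L u (MkSlice b : Slice y)) c)
  ∘ adj_unit (pi_adj L u) (MkSlice b : Slice y).

(** One half of the bijection between transposes along [u^* ⊣ Π_u]; it is the
    first triangle identity. *)
Lemma pi_counit_curry (A : Slice x) (T : C) (b : Hom T y)
    (a : Hom (pb (pbk u b)) (tot A)) (c : arr A ∘ a = pr1 (pbk u b)) :
  shom (pi_counit L u A) ∘ shom (fmap (Pb L u) (pi_curry c)) = a.
Proof.
set a' := MkSliceHom (A := Pb L u (MkSlice b : Slice y)) c.
have n := nt_nat (pi_counit L u) a'.
have t := triangle_l (pi_adj L u) (MkSlice b : Slice y).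
have : pi_counit L u A ∘ fmap (Pb L u) (pi_curry c) = a'.
  rewrite /pi_curry fmap_comp comp_assoc -/a'.
  apply: eq_trans (f_equal (fun k => k ∘ _) n) _.
  by apply: eq_trans (eq_sym (comp_assoc _ _ _)) _; rewrite t comp_idr.
by move/(f_equal (@shom _ _ _ _)).
Qed.

Lemma pi_eval_curry (A : Slice x) (T : C) (b : Hom T y)
    (a : Hom (pb (pbk u b)) (tot A)) (c : arr A ∘ a = pr1 (pbk u b))
    (S : C) (t : Hom S (pb (pbk u b))) (w : Hom S x) (s : Hom S (tot (Pi L u A)))
    (c' : u ∘ w = arr (Pi L u A) ∘ s) :
  pr1 (pbk u b) ∘ t = w -> shom (pi_curry c) ∘ (pr2 (pbk u b) ∘ t) = s ->
  pi_eval c' = a ∘ t.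
Proof.
move=> ew es; rewrite -[X in X ∘ t](pi_counit_curry c) /pi_eval -comp_assoc.
congr (_ ∘ _); apply: (pair_uniq (p := pbk u (arr (Pi L u A)))).
- by rewrite pair_pr1 comp_assoc /= pair_pr1.
- by rewrite pair_pr2 comp_assoc /= pair_pr2 -comp_assoc.
Qed.

(** Two elements over the same [b] are maps of [C/y] out of [b]. By the second
    triangle identity such a map is determined by its transpose, which is the
    evaluation at the generic point of the pullback of [b] along [u]. *)
Lemma pi_ext (A : Slice x) (T : C) (s s' : Hom T (tot (Pi L u A))) :
  arr (Pi L u A) ∘ s = arr (Pi L u A) ∘ s' ->
  (forall (S : C) (v : Hom S T) (w : Hom S x)
     (c : u ∘ w = arr (Pi L u A) ∘ (s ∘ v)) (c' : u ∘ w = arr (Pi L u A) ∘ (s' ∘ v)),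
     pi_eval c = pi_eval c') ->
  s = s'.
Proof.
move=> es ev.
pose b := arr (Pi L u A) ∘ s'.
pose h : Hom (MkSlice b : Slice y) (Pi L u A) := MkSliceHom (A := MkSlice b) es.
pose h' : Hom (MkSlice b : Slice y) (Pi L u A) := MkSliceHom (A := MkSlice b) eq_refl.
suff hh' : h = h' by exact: (f_equal (@shom _ _ _ _) hh').
have transposeK (k : Hom (MkSlice b : Slice y) (Pi L u A)) :
    k = fmap (Pi L u) (pi_counit L u A ∘ fmap (Pb L u) k)
        ∘ adj_unit (pi_adj L u) (MkSlice b : Slice y).
  have n := nt_nat (adj_unit (pi_adj L u)) k.
  have t := triangle_r (pi_adj L u) A.
  rewrite fmap_comp -comp_assoc.
  apply: eq_trans (f_equal (fun k => _ ∘ k) n).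
  rewrite comp_assoc; apply: eq_trans (f_equal (fun c => c ∘ _) (eq_sym t)).
  by rewrite comp_idl.
rewrite (transposeK h) (transposeK h'); congr (fmap _ _ ∘ _); apply: slice_hom_eq => /=.
have q : u ∘ pr1 (pbk u b) = arr (Pi L u A) ∘ (s ∘ pr2 (pbk u b)).
  by rewrite comp_assoc es pb_sq.
have q' : u ∘ pr1 (pbk u b) = arr (Pi L u A) ∘ (s' ∘ pr2 (pbk u b)).
  by rewrite comp_assoc pb_sq.
have evalE (k : Hom (MkSlice b : Slice y) (Pi L u A))
    (c : u ∘ pr1 (pbk u b) = arr (Pi L u A) ∘ (shom k ∘ pr2 (pbk u b))) :
    shom (pi_counit L u A) ∘ shom (fmap (Pb L u) k) = pi_eval c.
  rewrite /pi_eval; congr (_ ∘ _).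
  by apply: (pair_uniq (p := pbk u (arr (Pi L u A)))); rewrite /= ?pair_pr1 ?pair_pr2.
by rewrite (evalE h q) (evalE h' q'); apply: ev.
Qed.

Lemma pi_curry_id_sq (A : Slice x) (T : C) (b : Hom T y)
    (a : Hom (pb (pbk u b)) (tot A)) :
  arr A ∘ a = idm x ∘ pr1 (pbk u b) -> arr A ∘ a = pr1 (pbk u b).
Proof. by rewrite comp_idl. Qed.

Definition pi_sections : SectionsAlong L u (idm x) (Pi L u).
Proof.
unshelve refine {|
  sec_ev := fun A T w s c => pi_eval c;
  sec_curry := fun A T b a c => shom (pi_curry (pi_curry_id_sq c)) |}.
- abstract by move=> A T w s c; rewrite pi_eval_arr comp_idl.
- abstract exact: (@pi_eval_nat C L x y u).
- abstract by move=> A T b a c; apply: (shom_comm (pi_curry (pi_curry_id_sq c))).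
- abstract by move=> A T b a c S t w s c' ew es; apply: (pi_eval_curry c' ew es).
- abstract exact: pi_ext.
Defined.

End PiSections.

(** [Π_e q^* r^* = Π_e (r q)^*]. The composite is a parameter [q'], so that an
    identity factor can be absorbed. *)
Section PbSections.
Context (E B Z Y : C) (e : Hom E B) (q : Hom E Z) (r : Hom Z Y) (q' : Hom E Y).
Context (rq : r ∘ q = q').
Context (F : Functor (Slice Z) (Slice B)) (sF : SectionsAlong L e q F).

Lemma pb_curry_sq (A : Slice Y) (T : C) (b : Hom T B)
    (a : Hom (pb (pbk e b)) (tot A)) (c : arr A ∘ a = q' ∘ pr1 (pbk e b)) :
  r ∘ (q ∘ pr1 (pbk e b)) = arr A ∘ a.
Proof. by rewrite c comp_assoc rq. Qed.

Definition pb_curry (A : Slice Y) (T : C) (b : Hom T B)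
    (a : Hom (pb (pbk e b)) (tot A)) (c : arr A ∘ a = q' ∘ pr1 (pbk e b)) :
    Hom T (tot (F (Pb L r A))) :=
  sec_curry sF (A := Pb L r A) (pair_pr1 (pbk r (arr A)) (pb_curry_sq c)).

Definition sections_pb : SectionsAlong L e q' (F ∘F Pb L r).
Proof.
unshelve refine (@Build_SectionsAlong C L _ _ _ e q' (F ∘F Pb L r)
  (fun A T w s c => pr2 (pbk r (arr A)) ∘ sec_ev sF (A := Pb L r A) c) _ _
  (fun A T b a c => pb_curry c) _ _ _).
- abstract by move=> A T w s c; rewrite comp_assoc -pb_sq -comp_assoc
    (sec_ev_arr sF (A := Pb L r A) c) comp_assoc rq.
- abstract by move=> A A' a S T v w s c w' s' c' ew es; rewrite -comp_assoc
    (sec_ev_nat sF (a := fmap (Pb L r) a) c c' ew es) !comp_assoc /= pair_pr2.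
- abstract by move=> A T b a c; apply: (sec_curry_arr sF (A := Pb L r A)).
- abstract by move=> A T b a c S t w s c' ew es;
    rewrite (sec_beta sF (A := Pb L r A)
      (c := pair_pr1 (pbk r (arr A)) (pb_curry_sq c)) c' ew es) comp_assoc pair_pr2.
- abstract (move=> A T s s' es H; apply: (sec_ext sF (A := Pb L r A)) => //;
    move=> S v w c c'; apply: (pair_uniq (p := pbk r (arr A))); [
      by apply: eq_trans (sec_ev_arr sF c) (eq_sym (sec_ev_arr sF c'))
    | by apply: H]).
Defined.

End PbSections.

(** [Π_u Π_e q^* = Π_(u e) q^*]: evaluating at a point [w] of [E] means evaluating
    first at [e w], then at [w]. *)
Section CompSections.
Context (E D B Y : C) (u : Hom D B) (e : Hom E D) (q : Hom E Y).
Context (F : Functor (Slice D) (Slice B)) (sF : SectionsAlong L u (idm D) F).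
Context (G : Functor (Slice Y) (Slice D)) (sG : SectionsAlong L e q G).

Lemma comp_ev_outer_sq (A : Slice Y) (T : C) (w : Hom T E) (s : Hom T (tot (F (G A)))) :
  u ∘ e ∘ w = arr (F (G A)) ∘ s -> u ∘ (e ∘ w) = arr (F (G A)) ∘ s.
Proof. by rewrite comp_assoc. Qed.

Lemma comp_ev_inner_sq (A : Slice Y) (T : C) (w : Hom T E) (s : Hom T (tot (F (G A))))
    (c : u ∘ e ∘ w = arr (F (G A)) ∘ s) :
  e ∘ w = arr (G A) ∘ sec_ev sF (comp_ev_outer_sq c).
Proof. by rewrite sec_ev_arr comp_idl. Qed.

Definition comp_ev (A : Slice Y) (T : C) (w : Hom T E) (s : Hom T (tot (F (G A))))
    (c : u ∘ e ∘ w = arr (F (G A)) ∘ s) : Hom T (tot A) :=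
  sec_ev sG (comp_ev_inner_sq c).

Section Curry.
Context (A : Slice Y) (T : C) (b : Hom T B) (a : Hom (pb (pbk (u ∘ e) b)) (tot A)).
Context (c : arr A ∘ a = q ∘ pr1 (pbk (u ∘ e) b)).

Notation P1 := (pbk e (pr1 (pbk u b))).

Lemma pb_comp_sq :
  u ∘ e ∘ pr1 P1 = b ∘ (pr2 (pbk u b) ∘ pr2 P1).
Proof. by rewrite comp_assoc -pb_sq -!comp_assoc pb_sq. Qed.

Definition pb_comp : Hom (pb P1) (pb (pbk (u ∘ e) b)) :=
  pair (pbk (u ∘ e) b) pb_comp_sq.

Lemma comp_curry_inner_sq : arr A ∘ (a ∘ pb_comp) = q ∘ pr1 P1.
Proof. by rewrite comp_assoc c -comp_assoc pair_pr1. Qed.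

Definition comp_curry_inner : Hom (pb (pbk u b)) (tot (G A)) :=
  sec_curry sG comp_curry_inner_sq.

Lemma comp_curry_outer_sq : arr (G A) ∘ comp_curry_inner = idm D ∘ pr1 (pbk u b).
Proof. by rewrite comp_idl; apply: sec_curry_arr. Qed.

Definition comp_curry : Hom T (tot (F (G A))) := sec_curry sF comp_curry_outer_sq.

Lemma comp_ev_curry (S : C) (t : Hom S (pb (pbk (u ∘ e) b))) (w : Hom S E)
    (s : Hom S (tot (F (G A)))) (c' : u ∘ e ∘ w = arr (F (G A)) ∘ s) :
  pr1 (pbk (u ∘ e) b) ∘ t = w -> comp_curry ∘ (pr2 (pbk (u ∘ e) b) ∘ t) = s ->
  comp_ev c' = a ∘ t.
Proof.
move=> ew es.
have e1 : u ∘ (e ∘ pr1 (pbk (u ∘ e) b) ∘ t) = b ∘ (pr2 (pbk (u ∘ e) b) ∘ t).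
  by rewrite !comp_assoc pb_sq.
pose t1 := pair (pbk u b) e1.
have e2 : e ∘ w = pr1 (pbk u b) ∘ t1 by rewrite pair_pr1 -ew comp_assoc.
pose t2 := pair P1 e2.
have -> : t = pb_comp ∘ t2.
  apply: (pair_uniq (p := pbk (u ∘ e) b)); rewrite comp_assoc.
    by rewrite pair_pr1 pair_pr1.
  by rewrite pair_pr2 -comp_assoc pair_pr2 pair_pr2.
rewrite comp_assoc; apply: (sec_beta sG (c := comp_curry_inner_sq)).
- exact: pair_pr1.
- rewrite pair_pr2; apply: eq_sym; apply: (sec_beta sF (c := comp_curry_outer_sq)).
  + by rewrite pair_pr1 -ew comp_assoc.
  + by rewrite pair_pr2.
Qed.

End Curry.

Lemma comp_ext (A : Slice Y) (T : C) (s s' : Hom T (tot (F (G A)))) :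
  arr (F (G A)) ∘ s = arr (F (G A)) ∘ s' ->
  (forall (S : C) (v : Hom S T) (w : Hom S E)
     (c : u ∘ e ∘ w = arr (F (G A)) ∘ (s ∘ v))
     (c' : u ∘ e ∘ w = arr (F (G A)) ∘ (s' ∘ v)), comp_ev c = comp_ev c') ->
  s = s'.
Proof.
move=> es H; apply: (sec_ext sF) => // S v w c c'.
apply: (sec_ext sG); first by rewrite !sec_ev_arr.
move=> S' v' w' d d'.
have ew : e ∘ w' = w ∘ v' by rewrite d comp_assoc sec_ev_arr comp_idl.
have f r (k : u ∘ w = arr (F (G A)) ∘ (r ∘ v)) :
    u ∘ e ∘ w' = arr (F (G A)) ∘ (r ∘ (v ∘ v')).
  by rewrite -comp_assoc ew comp_assoc k !comp_assoc.
have ev r (k : u ∘ w = arr (F (G A)) ∘ (r ∘ v))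
    (l : e ∘ w' = arr (G A) ∘ (sec_ev sF k ∘ v')) : sec_ev sG l = comp_ev (f r k).
  apply: sec_ev_eq => //; apply: sec_ev_sub => //.
  by rewrite comp_assoc.
by rewrite (ev s c d) (ev s' c' d'); apply: H.
Qed.

Definition sections_comp : SectionsAlong L (u ∘ e) q (F ∘F G).
Proof.
unshelve refine (@Build_SectionsAlong C L _ _ _ (u ∘ e) q (F ∘F G)
  (fun A T w s c => comp_ev (A := A) (s := s) c) _ _
  (fun A T b a c => comp_curry c) _ _ _).
- abstract by move=> A T w s c; apply: sec_ev_arr.
- abstract by move=> A A' a S T v w s c w' s' c' ew es; apply: sec_ev_nat => //;
    apply: sec_ev_nat => //; rewrite -comp_assoc ew.
- abstract by move=> A T b a c; apply: (sec_curry_arr sF (comp_curry_outer_sq c)).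
- abstract by move=> A T b a c S t w s c' ew es; apply: (comp_ev_curry c' ew es).
- abstract exact: comp_ext.
Defined.

End CompSections.

End SectionsTheory.

(** * Beck-Chevalley for functors of sections *)

(** A functor of sections along the pullback of [e] by [p : W -> B] takes [A] to the
    pullback of [F A] by [p]: an element of either over [w : T -> W] is a family
    over the fibres of [e] above [p w]. The pullbacks [Q A] are arbitrary, as the
    one that occurs below is not the chosen one. *)
Section BaseChange.
Context (C : Category) (L : LocallyCartesianClosed C).
Notation pbk u v := (lcc_pullback L u v).

Context (E B W Y : C) (e : Hom E B) (p : Hom W B) (q : Hom E Y).
Context (F : Functor (Slice Y) (Slice B)) (sF : SectionsAlong L e q F).
Context (X : Pullback p e).
Context (G : Functor (Slice Y) (Slice W)) (sG : SectionsAlong L (pr1 X) (q ∘ pr2 X) G).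
Context (Q : forall A, Pullback (arr (F A)) p).

Section Maps.
Context (A : Slice Y).

Lemma base_change_pt_sq (S : C) (w : Hom S E) (s : Hom S (tot (G A))) :
  e ∘ w = p ∘ arr (G A) ∘ s -> p ∘ (arr (G A) ∘ s) = e ∘ w.
Proof. by rewrite comp_assoc. Qed.

Definition base_change_pt (S : C) (w : Hom S E) (s : Hom S (tot (G A)))
    (c : e ∘ w = p ∘ arr (G A) ∘ s) : Hom S (pb X) :=
  pair X (base_change_pt_sq c).

Lemma base_change_pt_arr (S : C) (w : Hom S E) (s : Hom S (tot (G A)))
    (c : e ∘ w = p ∘ arr (G A) ∘ s) : pr1 X ∘ base_change_pt c = arr (G A) ∘ s.
Proof. exact: pair_pr1. Qed.

Notation P := (pbk e (p ∘ arr (G A))).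

Lemma base_change_to_sq :
  arr A ∘ sec_ev sG (base_change_pt_arr (pb_sq P)) = q ∘ pr1 P.
Proof. by rewrite sec_ev_arr -comp_assoc pair_pr2. Qed.

Definition base_change_to_F : Hom (tot (G A)) (tot (F A)) := sec_curry sF base_change_to_sq.

Lemma base_change_to_F_arr : arr (F A) ∘ base_change_to_F = p ∘ arr (G A).
Proof. exact: sec_curry_arr. Qed.

Definition base_change_to : Hom (tot (G A)) (pb (Q A)) := pair (Q A) base_change_to_F_arr.

(** The comparison map does not change values, only the index: the fibre of [X] over a
    point [w] of [W] is the fibre of [E] over [p w], by [pr2 X]. *)
Lemma base_change_ev_to (S : C) (x : Hom S (pb X)) (s : Hom S (tot (G A)))
    (c : pr1 X ∘ x = arr (G A) ∘ s) (w : Hom S E) (r : Hom S (tot (F A)))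
    (c' : e ∘ w = arr (F A) ∘ r) :
  pr2 X ∘ x = w -> r = base_change_to_F ∘ s -> sec_ev sF c' = sec_ev sG c.
Proof.
move=> ew er.
have d : e ∘ w = p ∘ arr (G A) ∘ s by rewrite -ew comp_assoc -pb_sq -comp_assoc c comp_assoc.
rewrite (sec_beta sF (c := base_change_to_sq) (t := pair P d) c').
- exact: pair_pr1.
- by rewrite pair_pr2 er.
- apply: sec_ev_sub; last exact: pair_pr2.
  apply: (pair_uniq (p := X)); rewrite comp_assoc.
  + by rewrite base_change_pt_arr -comp_assoc pair_pr2 c.
  + by rewrite pair_pr2 pair_pr1 ew.
Qed.

Notation P' := (pbk (pr1 X) (pr2 (Q A))).

Lemma base_change_from_ev_sq : e ∘ (pr2 X ∘ pr1 P') = arr (F A) ∘ (pr1 (Q A) ∘ pr2 P').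
Proof. by rewrite !comp_assoc -(pb_sq X) (pb_sq (Q A)) -!comp_assoc pb_sq. Qed.

Lemma base_change_from_sq : arr A ∘ sec_ev sF base_change_from_ev_sq = q ∘ pr2 X ∘ pr1 P'.
Proof. by rewrite sec_ev_arr comp_assoc. Qed.

Definition base_change_from : Hom (pb (Q A)) (tot (G A)) := sec_curry sG base_change_from_sq.

Lemma base_change_from_arr : arr (G A) ∘ base_change_from = pr2 (Q A).
Proof. exact: sec_curry_arr. Qed.

Lemma base_change_ev_from (S : C) (x : Hom S (pb X)) (v : Hom S (pb (Q A))) (s : Hom S (tot (G A)))
    (c : pr1 X ∘ x = arr (G A) ∘ s) (w : Hom S E) (r : Hom S (tot (F A)))
    (c' : e ∘ w = arr (F A) ∘ r) :
  s = base_change_from ∘ v -> pr2 X ∘ x = w -> r = pr1 (Q A) ∘ v ->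
  sec_ev sG c = sec_ev sF c'.
Proof.
move=> es ew er.
have d : pr1 X ∘ x = pr2 (Q A) ∘ v by rewrite c es comp_assoc base_change_from_arr.
rewrite (sec_beta sG (c := base_change_from_sq) (t := pair P' d) c).
- exact: pair_pr1.
- by rewrite pair_pr2 es.
- by apply: sec_ev_sub; rewrite -comp_assoc ?pair_pr1 ?pair_pr2.
Qed.

Lemma base_change_to_pr1 : pr1 (Q A) ∘ base_change_to = base_change_to_F.
Proof. exact: pair_pr1. Qed.

Lemma base_change_to_pr2 : pr2 (Q A) ∘ base_change_to = arr (G A).
Proof. exact: pair_pr2. Qed.

(** The comparison maps preserve values in both directions, so their composites do;
    extensionality then makes these identities. *)
Lemma base_change_from_to : base_change_from ∘ base_change_to = idm (tot (G A)).
Proof.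
apply: (sec_ext sG); first by rewrite comp_assoc base_change_from_arr base_change_to_pr2 comp_idr.
move=> S v w c c'.
have d : e ∘ (pr2 X ∘ w) = arr (F A) ∘ (base_change_to_F ∘ v).
  by rewrite !comp_assoc base_change_to_F_arr -pb_sq -!comp_assoc c' comp_idl.
rewrite (base_change_ev_from (v := base_change_to ∘ v) c d) //.
- by rewrite comp_assoc.
- by rewrite comp_assoc base_change_to_pr1.
- by apply: base_change_ev_to; rewrite ?comp_idl.
Qed.

Lemma base_change_to_from : base_change_to ∘ base_change_from = idm (pb (Q A)).
Proof.
apply: (pair_uniq (p := Q A)); last first.
  by rewrite comp_assoc base_change_to_pr2 base_change_from_arr comp_idr.
rewrite comp_assoc base_change_to_pr1 comp_idr.
apply: (sec_ext sF).
  by rewrite comp_assoc base_change_to_F_arr -comp_assoc base_change_from_arr pb_sq.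
move=> S v w c c'.
have d : e ∘ w = p ∘ arr (G A) ∘ (base_change_from ∘ v).
  by rewrite -[X in _ = X]comp_assoc (comp_assoc (arr _)) base_change_from_arr c' !comp_assoc pb_sq.
rewrite (base_change_ev_to (base_change_pt_arr d)).
- exact: pair_pr2.
- by rewrite comp_assoc.
- by apply: base_change_ev_from; rewrite // pair_pr2.
Qed.

End Maps.

Lemma base_change_to_F_nat (A A' : Slice Y) (a : Hom A A') :
  base_change_to_F A' ∘ shom (fmap G a) = shom (fmap F a) ∘ base_change_to_F A.
Proof.
apply: (sec_ext sF).
  rewrite !comp_assoc base_change_to_F_arr (shom_comm (fmap F a)) base_change_to_F_arr.
  by rewrite -comp_assoc (shom_comm (fmap G a)).
move=> S v w c c'.
have d : e ∘ w = p ∘ arr (G A') ∘ (shom (fmap G a) ∘ v).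
  by rewrite c !comp_assoc base_change_to_F_arr.
have d' : e ∘ w = p ∘ arr (G A) ∘ v.
  by rewrite d -!comp_assoc (comp_assoc (arr _)) (shom_comm (fmap G a)).
have d2 : e ∘ w = arr (F A) ∘ (base_change_to_F A ∘ v).
  by rewrite comp_assoc base_change_to_F_arr.
rewrite (base_change_ev_to (base_change_pt_arr d)); [exact: pair_pr2 | by rewrite comp_assoc |].
rewrite (sec_ev_map sF (s' := base_change_to_F A ∘ v) (w' := w) (a := a) c' d2) ?comp_assoc //.
rewrite (base_change_ev_to (base_change_pt_arr d') d2) //; first exact: pair_pr2.
apply: (sec_ev_map sG) => //.
apply: (pair_uniq (p := X)); rewrite ?pair_pr2 // !pair_pr1.
by rewrite comp_assoc (shom_comm (fmap G a)).
Qed.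

End BaseChange.

(** * Isomorphisms between pointwise pushouts under the identity *)

(* Otherwise simplification exposes the colimit behind the pushout. *)
#[local] Opaque pp_pushout.

Section PushoutIso.
Context (C : Category) (FC : FinitelyCocomplete C) (z : C).
Context (S T S' T' : Functor (Slice z) (Slice z)).
Context (l : NatTrans S (id_functor (Slice z))) (r : NatTrans S T).
Context (l' : NatTrans S' (id_functor (Slice z))) (r' : NatTrans S' T').
Context (t : NatTrans T T') (s : forall A, Hom (S A) (S' A)).
Context (ls : forall A, l' A ∘ s A = l A) (rs : forall A, r' A ∘ s A = t A ∘ r A).

Lemma pp_hom_sq (A : Slice z) :
  in1 (pp_pushout FC l' r' A) ∘ shom (l A) =
  in2 (pp_pushout FC l' r' A) ∘ shom (t A) ∘ shom (r A).
Proof.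
have /(f_equal (@shom _ _ _ _)) /= <- := ls A.
have /(f_equal (@shom _ _ _ _)) /= e := rs A.
by rewrite -[X in _ = X]comp_assoc -e !comp_assoc (po_sq (pp_pushout FC l' r' A)).
Qed.

Definition pp_hom_map (A : Slice z) :
    Hom (po (pp_pushout FC l r A)) (po (pp_pushout FC l' r' A)) :=
  copair (pp_pushout FC l r A) (pp_hom_sq A).

Lemma pp_hom_arr (A : Slice z) :
  arr (pp_functor FC l' r' A) ∘ pp_hom_map A = arr (pp_functor FC l r A).
Proof.
apply: (copair_uniq (p := pp_pushout FC l r A)); rewrite -comp_assoc /pp_hom_map /=.
- by rewrite !copair_in1.
- by rewrite !copair_in2 comp_assoc copair_in2 shom_comm.
Qed.

Definition pp_hom : NatTrans (pp_functor FC l r) (pp_functor FC l' r').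
Proof.
unshelve refine (@Build_NatTrans _ _ (pp_functor FC l r) (pp_functor FC l' r')
  (fun A => MkSliceHom (A := pp_functor FC l r A) (B := pp_functor FC l' r' A)
     (pp_hom_arr A)) _).
abstract (move=> A B a; apply: slice_hom_eq;
  have /(f_equal (@shom _ _ _ _)) /= n := nt_nat t a;
  apply: (copair_uniq (p := pp_pushout FC l r A)); rewrite /= /pp_hom_map -!comp_assoc;
  [by rewrite !copair_in1 comp_assoc !copair_in1
  |by rewrite !copair_in2 !comp_assoc !copair_in2 -!comp_assoc n]).
Defined.

End PushoutIso.

Lemma pp_hom_inv (C : Category) (FC : FinitelyCocomplete C) (z : C)
    (S T S' T' : Functor (Slice z) (Slice z))
    (l : NatTrans S (id_functor (Slice z))) (r : NatTrans S T)
    (l' : NatTrans S' (id_functor (Slice z))) (r' : NatTrans S' T')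
    (t : NatTrans T T') (s : forall A, Hom (S A) (S' A))
    (ls : forall A, l' A ∘ s A = l A) (rs : forall A, r' A ∘ s A = t A ∘ r A)
    (t' : NatTrans T' T) (s' : forall A, Hom (S' A) (S A))
    (ls' : forall A, l A ∘ s' A = l' A) (rs' : forall A, r A ∘ s' A = t' A ∘ r' A)
    (A : Slice z) :
  t' A ∘ t A = idm (T A) ->
  pp_hom FC ls' rs' A ∘ pp_hom FC ls rs A = idm (pp_functor FC l r A).
Proof.
move=> /(f_equal (@shom _ _ _ _)) /= tt; apply: slice_hom_eq.
apply: (copair_uniq (p := pp_pushout FC l r A)); rewrite /= /pp_hom_map -comp_assoc comp_idl.
- by rewrite !copair_in1.
- by rewrite copair_in2 comp_assoc copair_in2 -comp_assoc tt comp_idr.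
Qed.

(** Only the right feet of the two spans have to be isomorphic. The apexes need
    just comparison maps in both directions, over the right feet and the identity:
    these give maps between the pushouts in both directions, which are inverse
    because they are so on the feet. *)
Lemma pushout_pointed_iso (C : Category) (FC : FinitelyCocomplete C) (z : C)
    (S T S' T' : Functor (Slice z) (Slice z))
    (l : NatTrans S (id_functor (Slice z))) (r : NatTrans S T)
    (l' : NatTrans S' (id_functor (Slice z))) (r' : NatTrans S' T')
    (t : NatTrans T T') (t' : forall A, Hom (T' A) (T A))
    (s : forall A, Hom (S A) (S' A)) (s' : forall A, Hom (S' A) (S A)) :
  (forall A, t A ∘ t' A = idm (T' A)) -> (forall A, t' A ∘ t A = idm (T A)) ->
  (forall A, l' A ∘ s A = l A) -> (forall A, r' A ∘ s A = t A ∘ r A) ->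
  (forall A, l A ∘ s' A = l' A) -> (forall A, r A ∘ s' A = t' A ∘ r' A) ->
  PointedIso (pushout_pointed FC l r) (pushout_pointed FC l' r').
Proof.
move=> tt' t't ls rs ls' rs'.
have n A B (a : Hom A B) : t' B ∘ fmap T' a = fmap T a ∘ t' A.
  rewrite -[LHS]comp_idr -(tt' A) comp_assoc -[_ ∘ _ ∘ t A]comp_assoc.
  by rewrite -(nt_nat t a) comp_assoc t't comp_idl.
pose u : NatTrans T' T := Build_NatTrans n.
have rs'' A : r A ∘ s' A = u A ∘ r' A by apply: rs'.
exists (pp_hom FC ls rs : NatTrans (pushout_pointed FC l r) (pushout_pointed FC l' r'))
  (pp_hom FC ls' rs'' : NatTrans (pushout_pointed FC l' r') (pushout_pointed FC l r)).
- by move=> A; apply: (pp_hom_inv FC ls' rs'' ls rs (tt' A)).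
- by move=> A; apply: (pp_hom_inv FC ls rs ls' rs'' (t't A)).
- by move=> A; apply: slice_hom_eq; apply: copair_in1.
Qed.

(** * Spans on a functor of sections *)

(** The universal property for a prescribed vertex: the feet and apexes compared
    here are constructed as other limits than the pullbacks they turn out to be. *)
Record IsPullback (C : Category) (x y z P : C) (f : Hom x z) (g : Hom y z)
    (p1 : Hom P x) (p2 : Hom P y) := {
  ip_sq : f ∘ p1 = g ∘ p2;
  ip_pair : forall (w : C) (a : Hom w x) (b : Hom w y), f ∘ a = g ∘ b -> Hom w P;
  ip_pair1 : forall w (a : Hom w x) (b : Hom w y) (e : f ∘ a = g ∘ b),
    p1 ∘ ip_pair e = a;
  ip_pair2 : forall w (a : Hom w x) (b : Hom w y) (e : f ∘ a = g ∘ b),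
    p2 ∘ ip_pair e = b;
  ip_uniq : forall w (h h' : Hom w P),
    p1 ∘ h = p1 ∘ h' -> p2 ∘ h = p2 ∘ h' -> h = h'
}.

Definition pullback_of (C : Category) (x y z P : C) (f : Hom x z) (g : Hom y z)
    (p1 : Hom P x) (p2 : Hom P y) (i : IsPullback f g p1 p2) : Pullback f g :=
  {| pb_sq := ip_sq i; pair_pr1 := ip_pair1 i; pair_pr2 := ip_pair2 i;
     pair_uniq := ip_uniq i |}.

(** Let [K] be the functor of sections along [p e], with [e : E -> W] and
    [p : W -> B]. The second span has as feet the identity and [K A ×_B W], its
    apex is [K A ×_B E], and its left leg evaluates sections. The first span has
    the functor [G] of sections along the pullback of [p e] by [p] as right
    foot and [G A ×_W E] as apex, and its left leg evaluates at the points of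
    the pullback given by the diagonal [d]; its data carry a prime. Base change
    identifies [G A] with [K A ×_B W], hence both apexes with [K A ×_B E]. *)
Section SpanIso.
Context (C : Category) (FC : FinitelyCocomplete C) (L : LocallyCartesianClosed C).
Context (E W B Y : C) (e : Hom E W) (p : Hom W B) (q : Hom W Y).
Context (K : Functor (Slice Y) (Slice B)) (sK : SectionsAlong L (p ∘ e) (q ∘ e) K).
Context (X : Pullback p (p ∘ e)) (d : Hom E (pb X)).
Context (d1 : pr1 X ∘ d = e) (d2 : pr2 X ∘ d = idm E).
Context (G : Functor (Slice Y) (Slice W)).
Context (sG : SectionsAlong L (pr1 X) (q ∘ e ∘ pr2 X) G).

Context (S' : Functor (Slice Y) (Slice Y)).
Context (l' : NatTrans S' (id_functor (Slice Y))) (r' : NatTrans S' (Sigma q ∘F G)).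
Context (eS' : forall A, Hom (tot (S' A)) E).
Context (iS' : forall A,
  IsPullback (pr1 X ∘ d) (arr (G A)) (eS' A) (shom (r' A) : Hom _ (tot (G A)))).
Context (lE' : forall A
  (c : pr1 X ∘ (d ∘ eS' A) = arr (G A) ∘ (shom (r' A) : Hom _ (tot (G A)))),
  shom (l' A) = sec_ev sG c).

Context (S T : Functor (Slice Y) (Slice Y)).
Context (l : NatTrans S (id_functor (Slice Y))) (r : NatTrans S T).
Context (kT : forall A, Hom (tot (T A)) (tot (K A))) (wT : forall A, Hom (tot (T A)) W).
Context (iT : forall A, IsPullback (arr (K A)) p (kT A) (wT A)).
Context (arrT : forall A, arr (T A) = q ∘ wT A).
Context (kT_nat : forall A A' (a : Hom A A'),
  kT A' ∘ shom (fmap T a) = shom (fmap K a) ∘ kT A).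
Context (wT_nat : forall A A' (a : Hom A A'), wT A' ∘ shom (fmap T a) = wT A).
Context (kS : forall A, Hom (tot (S A)) (tot (K A))) (eS : forall A, Hom (tot (S A)) E).
Context (iS : forall A, IsPullback (p ∘ e) (arr (K A)) (eS A) (kS A)).
Context (kr : forall A, kT A ∘ shom (r A) = kS A).
Context (wr : forall A, wT A ∘ shom (r A) = e ∘ eS A).
Context (lE : forall A, shom (l A) = sec_ev sK (ip_sq (iS A))).

Notation Q := (fun A => pullback_of (iT A)).

Section Components.
Context (A : Slice Y).
Notation val := (shom (r' A) : Hom (tot (S' A)) (tot (G A))).

Definition to_T : Hom (tot (G A)) (tot (T A)) := base_change_to sK sG Q A.
Definition of_T : Hom (tot (T A)) (tot (G A)) := base_change_from sK sG Q A.

Lemma to_T_w : wT A ∘ to_T = arr (G A).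
Proof. exact: (base_change_to_pr2 sK sG Q A). Qed.

Lemma of_T_arr : arr (G A) ∘ of_T = wT A.
Proof. exact: (base_change_from_arr sK sG Q A). Qed.

Lemma to_T_comm : arr (T A) ∘ to_T = arr ((Sigma q ∘F G) A).
Proof. by rewrite arrT -comp_assoc to_T_w. Qed.

Lemma of_T_comm : arr ((Sigma q ∘F G) A) ∘ of_T = arr (T A).
Proof. by rewrite arrT -of_T_arr comp_assoc. Qed.

Lemma val_arr : arr (G A) ∘ val = e ∘ eS' A.
Proof. by rewrite -(ip_sq (iS' A)) d1. Qed.

Lemma to_S_sq : p ∘ e ∘ eS' A = arr (K A) ∘ (kT A ∘ (to_T ∘ val)).
Proof.
rewrite comp_assoc (ip_sq (iT A)) -[RHS]comp_assoc [wT A ∘ _]comp_assoc.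
by rewrite to_T_w val_arr comp_assoc.
Qed.

Definition to_S : Hom (tot (S' A)) (tot (S A)) := ip_pair (iS A) to_S_sq.

Lemma to_S_right : shom (r A) ∘ to_S = to_T ∘ val.
Proof.
apply: (ip_uniq (iT A)); rewrite comp_assoc; first by rewrite kr ip_pair2.
by rewrite wr -comp_assoc ip_pair1 comp_assoc to_T_w val_arr.
Qed.

(** Evaluating a section at [w] of [E] amounts to evaluating its base change at
    the diagonal point of [w]. *)
Lemma to_S_left : shom (l A) ∘ to_S = shom (l' A).
Proof.
have c : pr1 X ∘ (d ∘ eS' A) = arr (G A) ∘ val by rewrite comp_assoc (ip_sq (iS' A)).
rewrite lE (lE' c) (sec_ev_sub sK _ to_S_sq) ?ip_pair1 ?ip_pair2 //.
apply: (base_change_ev_to (sG := sG)); first by rewrite comp_assoc d2 comp_idl.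
by rewrite comp_assoc; congr (_ ∘ _); apply: (base_change_to_pr1 sK sG Q A).
Qed.

Lemma of_S_sq : pr1 X ∘ d ∘ eS A = arr (G A) ∘ (of_T ∘ shom (r A)).
Proof. by rewrite d1 comp_assoc of_T_arr wr. Qed.

Definition of_S : Hom (tot (S A)) (tot (S' A)) := ip_pair (iS' A) of_S_sq.

Lemma of_S_right : val ∘ of_S = of_T ∘ shom (r A).
Proof. exact: ip_pair2. Qed.

Lemma of_S_left : shom (l' A) ∘ of_S = shom (l A).
Proof.
have c : pr1 X ∘ (d ∘ eS A) = arr (G A) ∘ (of_T ∘ shom (r A)).
  by rewrite comp_assoc of_S_sq.
have c' : pr1 X ∘ (d ∘ eS' A) = arr (G A) ∘ val by rewrite comp_assoc (ip_sq (iS' A)).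
rewrite (lE' c') lE (sec_ev_sub sG _ c _ of_S_right); first by rewrite -comp_assoc ip_pair1.
by apply: (base_change_ev_from (Q := Q)); rewrite ?comp_assoc ?d2 ?comp_idl ?kr.
Qed.

Lemma to_S_comm : arr (S A) ∘ to_S = arr (S' A).
Proof. by rewrite -(shom_comm (l A)) -comp_assoc to_S_left (shom_comm (l' A)). Qed.

Lemma of_S_comm : arr (S' A) ∘ of_S = arr (S A).
Proof. by rewrite -(shom_comm (l' A)) -comp_assoc of_S_left (shom_comm (l A)). Qed.

End Components.

Lemma to_T_nat A A' (a : Hom A A') :
  to_T A' ∘ shom (fmap G a) = shom (fmap T a) ∘ to_T A.
Proof.
have k B1 : kT B1 ∘ to_T B1 = base_change_to_F sK sG B1 := base_change_to_pr1 sK sG Q B1.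
apply: (ip_uniq (iT A')); rewrite !comp_assoc.
- by rewrite k base_change_to_F_nat kT_nat -comp_assoc k.
- by rewrite wT_nat !to_T_w (shom_comm (fmap G a)).
Qed.

Definition to_T_trans : NatTrans (Sigma q ∘F G) T.
Proof.
unshelve refine (@Build_NatTrans _ _ (Sigma q ∘F G) T
  (fun A => MkSliceHom (A := (Sigma q ∘F G) A) (B := T A) (to_T_comm A)) _).
abstract by move=> A A' a; apply: slice_hom_eq; apply: to_T_nat.
Defined.

Lemma sections_span_iso : PointedIso (pushout_pointed FC l' r') (pushout_pointed FC l r).
Proof.
apply: (@pushout_pointed_iso _ FC _ _ _ _ _ l' r' l r to_T_trans
  (fun A => MkSliceHom (A := T A) (B := (Sigma q ∘F G) A) (of_T_comm A))
  (fun A => MkSliceHom (to_S_comm A)) (fun A => MkSliceHom (of_S_comm A))) => A;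
  apply: slice_hom_eq.
- exact: (base_change_to_from sK sG Q A).
- exact: (base_change_from_to sK sG Q A).
- exact: to_S_left.
- exact: to_S_right.
- exact: of_S_left.
- exact: of_S_right.
Qed.

End SpanIso.

(** * The span of a polynomial with reductions *)

Section PolySections.
Context (C : Category) (L : LocallyCartesianClosed C) (Z : C).
Context (P : PolynomialWithReductions Z) (A : Slice Z).

Notation pbk u v := (lcc_pullback L u v).
Notation G := (Pi L (pr_f P) ∘F Pb L (pr_h P)).
Notation Pf := (pbk (pr_f P) (arr (G A))).
Notation Pk := (pbk (pr_k P) (pr1 Pf)).

Definition poly_sections : SectionsAlong L (pr_f P) (pr_h P) G :=
  sections_pb (comp_idr (pr_h P)) (pi_sections L (pr_f P)).

Lemma poly_right_shom : shom (poly_right L P A) = pr2 Pf ∘ pr2 Pk.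
Proof. exact: comp_idr. Qed.

Lemma poly_src_pair_inner_sq (T : C) (a : Hom T (pr_R P)) (b : Hom T (tot (G A))) :
  pr_f P ∘ pr_k P ∘ a = arr (G A) ∘ b -> pr_f P ∘ (pr_k P ∘ a) = arr (G A) ∘ b.
Proof. by rewrite comp_assoc. Qed.

Lemma poly_src_pair_sq (T : C) (a : Hom T (pr_R P)) (b : Hom T (tot (G A)))
    (c : pr_f P ∘ pr_k P ∘ a = arr (G A) ∘ b) :
  pr_k P ∘ a = pr1 Pf ∘ pair Pf (poly_src_pair_inner_sq c).
Proof. by rewrite pair_pr1. Qed.

(** Two successive pullbacks, along [f] and along [k], are one along [f k]. *)
Lemma poly_src_pullback :
  IsPullback (pr_f P ∘ pr_k P) (arr (G A)) (pr1 Pk)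
    (shom (poly_right L P A) : Hom _ (tot (G A))).
Proof.
rewrite poly_right_shom.
exists (fun T a b c => pair Pk (poly_src_pair_sq c)).
- by rewrite -comp_assoc (pb_sq Pk) !comp_assoc (pb_sq Pf).
- by move=> T a b c; rewrite pair_pr1.
- by move=> T a b c; rewrite -comp_assoc !pair_pr2.
- move=> T h h' e1 e2; apply: (pair_uniq (p := Pk)) => //.
  apply: (pair_uniq (p := Pf)); last by rewrite !comp_assoc.
  by rewrite !comp_assoc -(pb_sq Pk) -!comp_assoc e1.
Qed.

Lemma poly_left_sq : pr_f P ∘ (pr1 Pf ∘ pr2 Pk) = arr (G A) ∘ (pr2 Pf ∘ pr2 Pk).
Proof. by rewrite !comp_assoc (pb_sq Pf). Qed.

Lemma poly_left_ev : shom (poly_left L P A) = sec_ev poly_sections poly_left_sq.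
Proof.
rewrite -(sec_ev_sub poly_sections (pb_sq Pf) poly_left_sq eq_refl eq_refl).
have id : pair Pf (pb_sq Pf) = idm _.
  by apply: (pair_uniq (p := Pf)); rewrite ?pair_pr1 ?pair_pr2 comp_idr.
have -> : sec_ev poly_sections (pb_sq Pf) =
    pr2 (pbk (pr_h P) (arr A)) ∘ shom (pi_counit L (pr_f P) (Pb L (pr_h P) A)).
  rewrite /= /pi_eval; congr (_ ∘ _).
  by apply: eq_trans (f_equal (fun t => _ ∘ t) id) _; rewrite comp_idr.
rewrite -[RHS]comp_assoc -[LHS]comp_assoc; congr (_ ∘ _).
exact: pair_pr2.
Qed.

(** The composite of the three counits evaluates a section at the point [k r]. *)
Lemma poly_left_shom
    (c : pr_f P ∘ (pr_k P ∘ pr1 Pk) = arr (G A) ∘ shom (poly_right L P A)) :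
  shom (poly_left L P A) = sec_ev poly_sections c.
Proof.
rewrite poly_left_ev; apply: sec_ev_eq; first by rewrite (pb_sq Pk).
by rewrite poly_right_shom.
Qed.

End PolySections.

(** * The span of the universal family of lifting problems *)

Section UniversalFamilyPoly.
Context (C : Category) (FC : FinitelyCocomplete C) (L : LocallyCartesianClosed C).
Context (I : C) (U V : Slice I) (m : Hom U V) (J : C) (Y : Slice J).

Notation pbk u v := (lcc_pullback L u v).
Notation W := (uf_W L V Y).
Notation p := (pr2 W).
Notation E := (uf_U L m Y).
Notation ev := (uf_ev L V Y).
Notation K := (uf_K L m Y).

(** The fillers [Π_{v:V(i)} (U(i, v) -> X(j, β(v)))] are the sections of [X] over
    the pairs [(v, u)]: the product is [Π] along [p], the exponential is [Π] along
    [E -> W] of a pullback along the same map. *)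
Definition uf_K_sections : SectionsAlong L (p ∘ arr E) (ev ∘ arr E) K :=
  sections_comp (pi_sections L p)
    (sections_pb eq_refl
      (sections_pb (comp_idr (arr E)) (pi_sections L (arr E)))).

Lemma uf_elt_arr (f : Slice (tot Y)) :
  arr E ∘ uf_elt L m f = uf_toW L m f ∘ shom (fmap (Pb L (uf_idx L m f)) m).
Proof. exact: (pair_pr1 (pbk (uf_v L V Y) (shom m)) (uf_elt_sq L m f)). Qed.

Lemma uf_K_ev_sq (f : Slice (tot Y)) :
  p ∘ arr E ∘ uf_elt L m f = arr (K f) ∘ pr1 (pbk (uf_idx L m f) (arr U)).
Proof.
rewrite -(uf_fun_sq L m f) -comp_assoc; congr (_ ∘ _).
exact: uf_elt_arr.
Qed.

(** Both sides evaluate [φ] at [v] and the result at [u]. *)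
Lemma uf_K_ev_top (f : Slice (tot Y)) :
  sec_ev uf_K_sections (uf_K_ev_sq f) = uf_top L m f.
Proof.
have es := sec_ev_eq (pi_sections L p) (A := uf_fill L m Y f)
  (comp_ev_outer_sq (uf_K_ev_sq f)) (uf_fun_sq L m f)
  (uf_elt_arr f) eq_refl.
have et := sec_ev_eq (pi_sections L (arr E))
  (A := Pb L (arr E) (Pb L ev f))
  (comp_ev_inner_sq (pi_sections L p) (uf_K_ev_sq f)) (uf_app_sq L m f) eq_refl es.
exact: (f_equal (fun t =>
  pr2 (pbk ev (arr f)) ∘ (pr2 (pbk (arr E) (arr (Pb L ev f))) ∘ t)) et).
Qed.

(** [σ^*(V)] and [σ^*(U)] are defined as pullbacks over [I]. Pasting shows that they
    are also the pullbacks of [W] and [E] over the object [B] of triples [(i, j, β)],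
    to which the index of the family maps. *)
Section Squares.
Context (f : Slice (tot Y)).
Notation sV := (pbk (uf_idx L m f) (arr V)).
Notation sU := (pbk (uf_idx L m f) (arr U)).

Lemma uf_toW_K_sq : arr (K f) ∘ pr1 sV = p ∘ uf_toW L m f.
Proof. exact: eq_sym (pair_pr2 W (uf_toW_sq L m f)). Qed.

Lemma uf_sV_pair_sq (T : C) (k : Hom T (tot (K f))) (w : Hom T (pb W)) :
  arr (K f) ∘ k = p ∘ w -> uf_idx L m f ∘ k = arr V ∘ (uf_v L V Y ∘ w).
Proof.
move=> c; rewrite /uf_idx -comp_assoc c /uf_v.
rewrite -comp_assoc (comp_assoc (arr (uf_B L V Y))) -(pb_sq W).
by rewrite !comp_assoc -(pb_sq (pbk (pr1 (uf_IJ L I J)) (arr V))).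
Qed.

Lemma uf_sV_pair_W (T : C) (k : Hom T (tot (K f))) (w : Hom T (pb W))
    (c : arr (K f) ∘ k = p ∘ w) : uf_toW L m f ∘ pair sV (uf_sV_pair_sq c) = w.
Proof.
apply: (pair_uniq (p := W)); rewrite comp_assoc.
- rewrite (pair_pr1 W (uf_toW_sq L m f)).
  apply: (pair_uniq (p := pbk (pr1 (uf_IJ L I J)) (arr V))); rewrite comp_assoc.
  + rewrite (pair_pr1 _ (uf_toV_sq L m f)) -comp_assoc pair_pr1 -comp_assoc c.
    by rewrite comp_assoc -(pb_sq W) comp_assoc.
  + by rewrite (pair_pr2 _ (uf_toV_sq L m f)) pair_pr2 comp_assoc.
- by rewrite (pair_pr2 W (uf_toW_sq L m f)) -comp_assoc pair_pr1.
Qed.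

Lemma uf_toW_v : uf_v L V Y ∘ uf_toW L m f = pr2 sV.
Proof.
rewrite /uf_v -comp_assoc (pair_pr1 W (uf_toW_sq L m f)).
exact: (pair_pr2 _ (uf_toV_sq L m f)).
Qed.

Lemma uf_sV_uniq (T : C) (h h' : Hom T (pb sV)) :
  pr1 sV ∘ h = pr1 sV ∘ h' -> uf_toW L m f ∘ h = uf_toW L m f ∘ h' -> h = h'.
Proof.
move=> e1 e2; apply: (pair_uniq (p := sV)) => //.
by rewrite -uf_toW_v -!comp_assoc e2.
Qed.

Definition uf_sV_pullback : IsPullback (arr (K f)) p (pr1 sV) (uf_toW L m f) :=
  {| ip_sq := uf_toW_K_sq;
     ip_pair1 := fun T k w c => pair_pr1 sV (uf_sV_pair_sq c);
     ip_pair2 := uf_sV_pair_W;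
     ip_uniq := uf_sV_uniq |}.

Lemma uf_sU_pair_sq (T : C) (u : Hom T (tot E)) (k : Hom T (tot (K f))) :
  p ∘ arr E ∘ u = arr (K f) ∘ k ->
  uf_idx L m f ∘ k = arr U ∘ (pr2 (pbk (uf_v L V Y) (shom m)) ∘ u).
Proof.
move=> c; rewrite (uf_sV_pair_sq (w := arr E ∘ u)); first by rewrite comp_assoc c.
rewrite -(shom_comm m) -comp_assoc; congr (_ ∘ _); rewrite !comp_assoc.
exact: (f_equal (fun t => t ∘ u) (pb_sq (pbk (uf_v L V Y) (shom m)))).
Qed.

Lemma uf_sm_pr1 : pr1 sV ∘ shom (fmap (Pb L (uf_idx L m f)) m) = pr1 sU.
Proof. exact: pair_pr1. Qed.

Lemma uf_sm_pr2 : pr2 sV ∘ shom (fmap (Pb L (uf_idx L m f)) m) = shom m ∘ pr2 sU.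
Proof. exact: pair_pr2. Qed.

Lemma uf_sU_pair_elt (T : C) (u : Hom T (tot E)) (k : Hom T (tot (K f)))
    (c : p ∘ arr E ∘ u = arr (K f) ∘ k) :
  uf_elt L m f ∘ pair sU (uf_sU_pair_sq c) = u.
Proof.
apply: (pair_uniq (p := pbk (uf_v L V Y) (shom m))); rewrite comp_assoc; last first.
  by rewrite (pair_pr2 _ (uf_elt_sq L m f)) pair_pr2.
apply: eq_trans (f_equal (fun t => t ∘ _) (uf_elt_arr f)) _.
have d : arr (K f) ∘ k = p ∘ (arr E ∘ u) by rewrite comp_assoc c.
rewrite -comp_assoc -[X in _ = X](uf_sV_pair_W d); congr (_ ∘ _).
apply: (pair_uniq (p := sV)); rewrite comp_assoc.
- by rewrite uf_sm_pr1 !pair_pr1.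
- rewrite uf_sm_pr2 -comp_assoc !pair_pr2 !comp_assoc.
  exact: (f_equal (fun t => t ∘ u) (eq_sym (pb_sq (pbk (uf_v L V Y) (shom m))))).
Qed.

Lemma uf_sU_uniq (T : C) (h h' : Hom T (pb sU)) :
  uf_elt L m f ∘ h = uf_elt L m f ∘ h' -> pr1 sU ∘ h = pr1 sU ∘ h' -> h = h'.
Proof.
move=> e1 e2; apply: (pair_uniq (p := sU)) => //.
by rewrite -(pair_pr2 (pbk (uf_v L V Y) (shom m)) (uf_elt_sq L m f)) -!comp_assoc e1.
Qed.

Definition uf_sU_pullback :
    IsPullback (p ∘ arr E) (arr (K f)) (uf_elt L m f) (pr1 sU) :=
  {| ip_sq := uf_K_ev_sq f;
     ip_pair1 := uf_sU_pair_elt;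
     ip_pair2 := fun T u k c => pair_pr1 sU (uf_sU_pair_sq c);
     ip_uniq := uf_sU_uniq |}.

End Squares.

(** The total object of [X] consists of the [(i, j, β, v, v', u)] with [u : U(i, v')]. *)
Notation X := (pbk p (p ∘ arr E)).

Lemma uf_diag_sq : p ∘ arr E = p ∘ arr E ∘ idm (tot E).
Proof. by rewrite comp_idr. Qed.

(** The reductions are the entries with [v = v']. *)
Definition uf_diag : Hom (tot E) (pb X) := pair X uf_diag_sq.

Lemma uf_diag_pr1 : pr1 X ∘ uf_diag = arr E.
Proof. exact: pair_pr1. Qed.

Lemma uf_diag_pr2 : pr2 X ∘ uf_diag = idm (tot E).
Proof. exact: pair_pr2. Qed.

Lemma step1_poly_eq : ev ∘ pr1 X ∘ uf_diag = ev ∘ arr E ∘ pr2 X ∘ uf_diag.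
Proof.
rewrite -[LHS]comp_assoc -[RHS]comp_assoc uf_diag_pr1 uf_diag_pr2.
exact: eq_sym (comp_idr _).
Qed.

(** [f] forgets [(v', u)], [g] is [β(v)] and [h] is [β(v')]; they agree on the
    diagonal. *)
Definition step1_poly : PolynomialWithReductions (tot Y) :=
  {| pr_k := uf_diag; pr_f := pr1 X; pr_g := ev; pr_h := ev ∘ arr E ∘ pr2 X;
     pr_eq := step1_poly_eq |}.

Lemma step1_pointed_iso : PointedIso (poly_pointed FC L step1_poly) (step1 L m Y FC).
Proof.
apply: (@sections_span_iso C FC L _ _ _ _ (arr E) p ev K uf_K_sections
  X uf_diag uf_diag_pr1 uf_diag_pr2
  _ (poly_sections L step1_poly) _ (poly_left L step1_poly) (poly_right L step1_poly)
  _ (poly_src_pullback L step1_poly) (@poly_left_shom _ L _ step1_poly)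
  _ _ (step1_left L m Y) (step1_right L m Y) _ _ uf_sV_pullback _ _ _ _ _ uf_sU_pullback).
- by [].
- exact: (fun A A' a => restrict_pr1 L (uf_idx_map L m a) V).
- exact: uf_toW_map.
- exact: uf_sm_pr1.
- by move=> A; apply: eq_sym (uf_elt_arr A).
- by move=> A; apply: eq_sym (uf_K_ev_top A).
Qed.

End UniversalFamilyPoly.

Theorem theorem6p9 (C : Category) (FC : FinitelyCocomplete C)
    (L : LocallyCartesianClosed C) (I : C) (U V : Slice I) (m : Hom U V)
    (Y J : C) (y : Hom Y J) :
  pointed_polynomial FC L (step1 L m (MkSlice y : Slice J) FC).
Proof.
exists (step1_poly L m (MkSlice y : Slice J)).
by constructor; apply: step1_pointed_iso.
Qed.
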